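(* Let $\mathcal X,\mathcal Y\subset\mathbb R^d$ be compact convex sets with nonempty interior, $T\ge2$, and let $u_1,u_2:\mathcal X\times\mathcal Y\to[-1,1]$ be such that $u_1(\cdot,y)$ is convex for every $y\in\mathcal Y$ and $u_2(x,\cdot)$ is convex for every $x\in\mathcal X$. Consider the alternating learning dynamic run for $T$ rounds in which both $\mathsf{Alg}_x$ and $\mathsf{Alg}_y$ are the continuous Hedge algorithm with $\eta=(d\log T)^{1/3}T^{-1/3}$. If the game is zero-sum ($u_2=-u_1$), then $\left(\frac1T\sum_{t=1}^Tx_t,\frac1T\sum_{t=1}^Ty_t\right)$ is an $\varepsilon$-Nash equilibrium with $\varepsilon=\tilde{\mathcal O}(d^{2/3}T^{-2/3})$. Otherwise (general-sum), the uniform distribution over the $2T$ pairs $\{(x_t,y_t),(x_{t+1},y_t)\}_{t=1,\dots,T}$ is an $\varepsilon$-coarse correlated equilibrium with $\varepsilon=\tilde{\mathcal O}(d^{2/3}T^{-2/3})$.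
   Context: Here $\tilde{\mathcal O}(\cdot)$ hides absolute constants and logarithmic factors. Continuous Hedge with parameter $\eta>0$ on a set $\mathcal Z$: given past losses $g_1,\dots,g_k:\mathcal Z\to\mathbb R$ (possibly $k=0$), it outputs the mean $\int_{\mathcal Z}p(z)\,z\,dz$ of the probability density $p(z)\propto\exp(-\eta\sum_{\tau=1}^{k}g_\tau(z))$ on $\mathcal Z$. Alternating learning dynamic: for $t=1,\dots,T$, first $\mathsf{Alg}_x$ outputs $x_t\in\mathcal X$ from the past losses $u_1(\cdot,y_1),\dots,u_1(\cdot,y_{t-1})$; then $\mathsf{Alg}_y$ outputs $y_t\in\mathcal Y$ from the losses $u_2(x_1,\cdot),\dots,u_2(x_t,\cdot)$. The point $x_{T+1}$ is the output of $\mathsf{Alg}_x$ from the losses $u_1(\cdot,y_1),\dots,u_1(\cdot,y_T)$. A pair $(\bar x,\bar y)$ is an $\varepsilon$-Nash equilibrium if $u_1(\bar x,\bar y)\le u_1(x,\bar y)+\varepsilon$ for all $x\in\mathcal X$ and $u_2(\bar x,\bar y)\le u_2(\bar x,y)+\varepsilon$ for all $y\in\mathcal Y$. A probability distribution $\mathcal P$ on $\mathcal X\times\mathcal Y$ is an $\varepsilon$-coarse correlated equilibrium if $\mathbb E_{(x,y)\sim\mathcal P}[u_1(x,y)]\le \mathbb E_{(x,y)\sim\mathcal P}[u_1(x',y)]+\varepsilon$ for all $x'\in\mathcal X$ and $\mathbb E_{(x,y)\sim\mathcal P}[u_2(x,y)]\le\mathbb E_{(x,y)\sim\mathcal P}[u_2(x,y')]+\varepsilon$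 for all $y'\in\mathcal Y$. *)

(* Defs.v *)
From HB Require Import structures.
From mathcomp Require Import all_boot all_order all_algebra.
From mathcomp Require Import all_classical all_reals all_analysis.
Import Order.TTheory GRing.Theory Num.Theory.
Import numFieldNormedType.Exports.

Set Implicit Arguments.
Unset Strict Implicit.
Unset Printing Implicit Defensive.

Local Open Scope classical_set_scope.
Local Open Scope ring_scope.

Definition measure_row_display : measure_display -> measure_display.
Proof. exact. Qed.

(* Rows over a measurable type carry the product sigma-algebra, as tuples do;
   over the reals it is the Borel sigma-algebra of R^n. *)
Section measurable_row.
Context {d} {T : measurableType d}.
Variable n : nat.

Let coor (i : 'I_n) (v : 'rV[T]_n) : T := v ord0 i.

Let row_set0 : g_sigma_preimage coor set0.
Proof. exact: sigma_algebra0. Qed.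

Let row_setC A : g_sigma_preimage coor A -> g_sigma_preimage coor (~` A).
Proof. exact: sigma_algebraC. Qed.

Let row_bigcup (F : (set _)^nat) : (forall i, g_sigma_preimage coor (F i)) ->
  g_sigma_preimage coor (\bigcup_i (F i)).
Proof. exact: sigma_algebra_bigcup. Qed.

HB.instance Definition _ := @isMeasurable.Build (measure_row_display d)
  'rV[T]_n (g_sigma_preimage coor) row_set0 row_setC row_bigcup.

Lemma measurable_coor (i : 'I_n) :
  measurable_fun [set: 'rV[T]_n] (fun v : 'rV[T]_n => v ord0 i).
Proof.
move=> _ Y mY; rewrite setTI; apply: sub_sigma_algebra => /=.
rewrite -bigcup_seq/=; exists i => /=; first by rewrite mem_index_enum.
by exists Y => //; rewrite setTI.
Qed.

Lemma measurable_fun_row d' (S : measurableType d') (f : S -> 'rV[T]_n) :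
  (forall i, measurable_fun [set: S] (fun s => f s ord0 i)) ->
  measurable_fun [set: S] f.
Proof.
move=> mf; pose G := \big[setU/set0]_(i < n)
  preimage_set_system [set: 'rV[T]_n] (coor i) measurable.
apply: (@measurability _ _ _ _ _ _ G) => //.
move=> _ [A + <-]; rewrite /G -bigcup_seq/= => -[i _ [B mB <-]].
have := mf i measurableT _ mB; rewrite !setTI; exact.
Qed.

End measurable_row.

Section lebesgue_row.
Context {R : realType}.

Definition cons_row n (p : R * 'rV[R]_n) : 'rV[R]_n.+1 :=
  \row_i (if unlift ord0 i is Some j then p.2 ord0 j else p.1).

Lemma cons_row0 n (p : R * 'rV[R]_n) : cons_row p ord0 ord0 = p.1.
Proof. by rewrite mxE unlift_none. Qed.

Lemma cons_rowS n (p : R * 'rV[R]_n) i :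
  cons_row p ord0 (lift ord0 i) = p.2 ord0 i.
Proof. by rewrite mxE liftK. Qed.

Lemma measurable_cons_row n : measurable_fun [set: R * 'rV[R]_n] (@cons_row n).
Proof.
apply: measurable_fun_row => i.
have [->|[j ->]] : i = ord0 \/ exists j, i = lift ord0 j.
- by case: (unliftP ord0 i) => [j ->|->]; [right; exists j|left].
- under eq_fun do rewrite cons_row0.
  exact: measurable_fst.
- under eq_fun do rewrite cons_rowS.
  apply: (@measurableT_comp _ _ _ _ _ _ (fun v : 'rV[R]_n => v ord0 j)).
    exact: measurable_coor.
  exact: measurable_snd.
Qed.

Section lebesgue_succ.
Variables (n : nat) (m : {sigma_finite_measure set 'rV[R]_n -> \bar R}).

Definition lebesgue_succ : set 'rV[R]_n.+1 -> \bar R :=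
  pushforward (lebesgue_measure \x m)%E (@cons_row n).

Let lebesgue_succ0 : lebesgue_succ set0 = 0%E.
Proof. by rewrite /lebesgue_succ measure0//; exact: measurable_cons_row. Qed.

Let lebesgue_succ_ge0 A : (0 <= lebesgue_succ A)%E.
Proof. by apply: measure_ge0; exact: measurable_cons_row. Qed.

Let lebesgue_succ_sigma_additive : semi_sigma_additive lebesgue_succ.
Proof.
by apply: measure_semi_sigma_additive; exact: measurable_cons_row.
Qed.

HB.instance Definition _ := isMeasure.Build _ _ _ lebesgue_succ
  lebesgue_succ0 lebesgue_succ_ge0 lebesgue_succ_sigma_additive.

Let lebesgue_succ_sigma_finite : sigma_finite setT lebesgue_succ.
Proof.
have /sigma_finiteP[F [TF ndF Foo]] := sigma_finiteT (@lebesgue_measure R).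
have /sigma_finiteP[G [TG ndG Goo]] := sigma_finiteT m.
pose uncons (v : 'rV[R]_n.+1) : measurableTypeR R * 'rV[R]_n :=
  (v ord0 ord0, \row_j v ord0 (lift ord0 j)).
have muncons : measurable_fun [set: 'rV[R]_n.+1] uncons.
  apply/measurable_fun_pairP; split; first exact: measurable_coor.
  apply: measurable_fun_row => i.
  rewrite (_ : (fun _ => _) = fun v : 'rV[R]_n.+1 => v ord0 (lift ord0 i)).
    exact: measurable_coor.
  by apply/funext => v; rewrite mxE.
have consK p : uncons (cons_row p) = p.
  rewrite /uncons cons_row0; case: p => a v /=; congr pair.
  by apply/rowP => j; rewrite mxE cons_rowS.
exists (fun k => uncons @^-1` (F k `*` G k)).
  apply/seteqP; split=> // v _.
  have [k _ Fk] : (\bigcup_k F k) (uncons v).1 by rewrite -TF.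
  have [l _ Gl] : (\bigcup_k G k) (uncons v).2 by rewrite -TG.
  exists (maxn k l) => //; split.
    by move: Fk; exact/subsetPset/ndF/leq_maxl.
  by move: Gl; exact/subsetPset/ndG/leq_maxr.
move=> k; have [mF Fk] := Foo k; have [mG Gk] := Goo k; split.
  by rewrite -[X in measurable X]setTI; apply: muncons => //; exact: measurableX.
rewrite /lebesgue_succ /pushforward -comp_preimage.
rewrite (_ : uncons \o _ = id) ?preimage_id; last exact/funext.
by rewrite product_measure1E// lte_mul_pinfty// ge0_fin_numE.
Qed.

HB.instance Definition _ := Measure_isSigmaFinite.Build _ _ _ lebesgue_succ
  lebesgue_succ_sigma_finite.

End lebesgue_succ.

(* Lebesgue measure on R^n, as the n-fold product of the one-dimensional one. *)
Fixpoint lebesgue_row n : {sigma_finite_measure set 'rV[R]_n -> \bar R} :=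
  if n is n'.+1 return {sigma_finite_measure set 'rV[R]_n -> \bar R}
  then lebesgue_succ (lebesgue_row n') else \d_(0 : 'rV[R]_0).

Lemma lebesgue_row_box n (A : 'I_n -> set (measurableTypeR R)) :
  (forall i, measurable (A i)) ->
  lebesgue_row n [set v : 'rV[R]_n | forall i, A i (v ord0 i)] =
  (\prod_(i < n) lebesgue_measure (A i))%E.
Proof.
elim: n A => [|n IHn] A mA.
  rewrite big_ord0 /= /dirac indicE mem_set//=.
  by case.
pose B := [set v : 'rV[R]_n | forall i, A (lift ord0 i) (v ord0 i)].
have mB : measurable B.
  rewrite (_ : B = \bigcap_(i in [set: 'I_n])
      (fun v : 'rV[R]_n => v ord0 i) @^-1` A (lift ord0 i)).
    apply: fin_bigcap_measurable; first exact: finite_finset.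
    move=> i _; rewrite -[X in measurable X]setTI.
    exact: (measurable_coor i measurableT (mA _)).
  by apply/seteqP; split => v /= Bv i; [move=> _|]; exact: Bv.
rewrite big_ord_recl -IHn// -[RHS](product_measure1E _ _ (mA ord0) mB)/=.
rewrite /lebesgue_succ /pushforward; congr (_ _).
apply/seteqP; split => [p Ap|p [A0 AS] i] /=.
  split; first by rewrite /= -(cons_row0 p).
  by move=> i; rewrite -cons_rowS.
by case: (unliftP ord0 i) => [j ->|->]; rewrite ?cons_row0 ?cons_rowS//; exact: AS.
Qed.

End lebesgue_row.

Section continuous_hedge.
Context {R : realType} {d : nat}.
Implicit Types (Z : set 'rV[R]_d) (gs : seq ('rV[R]_d -> R)).

Definition hedge_weight (eta : R) gs (z : 'rV[R]_d) : R :=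
  expR (- eta * \sum_(g <- gs) g z).

Definition hedge_density (eta : R) Z gs (z : 'rV[R]_d) : R :=
  hedge_weight eta gs z / \int[lebesgue_row d]_(w in Z) hedge_weight eta gs w.

(* The vector-valued integral is taken coordinatewise. A convex loss may fail to
   be Borel on the boundary of Z; that boundary is null when Z is compact convex,
   and the integral, a supremum over measurable simple functions, ignores it. *)
Definition continuous_hedge (eta : R) Z gs : 'rV[R]_d :=
  \row_i \int[lebesgue_row d]_(z in Z) (hedge_density eta Z gs z * z ord0 i).

End continuous_hedge.

Section alternating_play.
Context {R : realType} {V W : Type}.

(* A learning algorithm maps the list of past losses to the next decision.
   Rounds are numbered from 1, and x is also defined at T + 1. *)
Definition alternating_play (algx : seq (V -> R) -> V)
    (algy : seq (W -> R) -> W) (u1 u2 : V -> W -> R) (T : nat)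
    (x : nat -> V) (y : nat -> W) : Prop :=
  (forall t, (1 <= t <= T.+1)%N ->
     x t = algx [seq u1^~ (y s) | s <- iota 1 t.-1]) /\
  (forall t, (1 <= t <= T)%N ->
     y t = algy [seq u2 (x s) | s <- iota 1 t]).

End alternating_play.

Section equilibria.
Context {R : realType} {d : nat}.
Implicit Types X Y : set 'rV[R]_d.

(* Players minimize their losses u1 and u2. *)
Definition nash_equilibrium X Y (u1 u2 : 'rV[R]_d -> 'rV[R]_d -> R)
    (eps : R) (xbar ybar : 'rV[R]_d) : Prop :=
  [/\ X xbar, Y ybar,
      forall x, X x -> u1 xbar ybar <= u1 x ybar + eps &
      forall y, Y y -> u2 xbar ybar <= u2 xbar y + eps].

Definition coarse_correlated_equilibrium X Y
    (u1 u2 : 'rV[R]_d -> 'rV[R]_d -> R) (eps : R)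
    (P : probability ('rV[R]_d * 'rV[R]_d)%type R) : Prop :=
  [/\ P (X `*` Y) = 1%E,
      forall x', X x' ->
        ('E_P[fun z => u1 z.1 z.2] <= 'E_P[fun z => u1 x' z.2] + eps%:E)%E &
      forall y', Y y' ->
        ('E_P[fun z => u2 z.1 z.2] <= 'E_P[fun z => u2 z.1 y'] + eps%:E)%E].

End equilibria.

(* Uniform distribution over the entries of a list, counted with multiplicity;
   the second argument of mnormalize is a default used only for the empty
   list. *)
Definition uniform_over {R : realType} {disp} {S : measurableType disp}
    (s : seq S) : probability S R :=
  mnormalize (msum (fun k => \d_(nth point s k)) (size s)) \d_point.

(* Main.v *)
(* For losses g_1, g_2, ... put W_t = exp (- eta (g_1 + ... + g_t)) and let Z_t
   be its integral over the domain. The cumulant generating function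
   s |-> ln E[exp (- s g_t)] for the density W_(t-1) / Z_(t-1) vanishes at 0,
   equals ln (Z_t / Z_(t-1)) at eta, and its derivatives at these two points are
   minus the mean losses of g_t before and after the update. By the trapezoid
   rule the average of the two mean losses is (ln Z_(t-1) - ln Z_t) / eta up to
   O(eta ^ 2), one order better than for either of them alone. Jensen's
   inequality passes from the densities to their means, the sum over t
   telescopes, and contracting the domain by 1 / T towards a comparator bounds
   Z_T from below, so that the alternating regret is
   O(d ln T / eta + eta ^ 2 T).
   The losses of the x-player on the 2T pairs form exactly an alternating
   regret; those of the y-player do so after a shift by one round, which costs
   O(1). In a zero-sum game the payoffs in the sum of the two regrets telescope,
   which bounds the duality gap of the averages. *)

Require Import Defs.
From HB Require Import structures.
From mathcomp Require Import all_boot all_order all_algebra.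
From mathcomp Require Import all_classical all_reals all_analysis.
From mathcomp Require Import measurable_realfun ring lra.
Import Order.TTheory GRing.Theory Num.Theory.
Import numFieldNormedType.Exports.
Local Open Scope classical_set_scope.
Local Open Scope ring_scope.

Set Implicit Arguments.
Unset Strict Implicit.
Unset Printing Implicit Defensive.

(** * Exponential bounds *)

Section exponential_bounds.
Context {R : realType}.
Implicit Types y : R.

Lemma expR_ge_quadratic y : 0 <= y -> 1 + y + y ^+ 2 / 2 <= expR y.
Proof.
move=> y0.
pose f (x : R) := expR x - (1 + x + x ^+ 2 / 2).
have df (x : R) : is_derive x 1 f (expR x - (1 + x)).
  rewrite /f; apply: is_derive_eq.
  rewrite /GRing.scale/=; field=> //.
have /(_ y0) : 0 <= y -> f 0 <= f y.
  apply: (@ger0_derive1_ndecry _ f 0 _ _ _ 0 y (lexx _)) => [x _|x _|].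
  - exact: ex_derive.
  - by rewrite derive1E derive_val subr_ge0 expR_ge1Dx.
  - apply: continuous_subspaceT => x.
    by apply: differentiable_continuous; apply/derivable1_diffP; exact: ex_derive.
by rewrite /f expR0 expr0n/=; lra.
Qed.

(** Inverting the previous bound at [- y] suffices: the two quadratics multiply to
    [1 + y ^+ 4 / 4 >= 1]. *)
Lemma expR_le_quadratic y : y <= 0 -> expR y <= 1 + y + y ^+ 2 / 2.
Proof.
move=> y0; have := @expR_ge_quadratic (- y); rewrite oppr_ge0 sqrrN => /(_ y0).
set q := 1 - y + _ => qE.
have q0 : 0 < q by rewrite /q; nra.
rewrite -[y in expR y]opprK expRN.
apply: (@le_trans _ _ q^-1); first by rewrite lef_pV2// posrE expR_gt0.
rewrite -div1r ler_pdivrMr// /q.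
have : 0 <= (y ^+ 2) ^+ 2 by rewrite sqr_ge0.
by rewrite !expr2; nra.
Qed.

(** The gap is nondecreasing: its derivative is nonnegative by [expR x <= 1 / (1 - x)] and
    [(1 - x) * (1 + x + 3 * x ^+ 2) >= 1]. *)
Lemma expR_le_cubic y : 0 <= y <= 1 / 2 ->
  expR y <= 1 + y + y ^+ 2 / 2 + y ^+ 3.
Proof.
case/andP=> y0 y1.
pose f (x : R) := 1 + x + x ^+ 2 / 2 + x ^+ 3 - expR x.
have df (x : R) : is_derive x 1 f (1 + x + 3 * x ^+ 2 - expR x).
  rewrite /f; apply: is_derive_eq.
  rewrite /GRing.scale/=; field=> //.
have /(_ y0 y1) : 0 <= y -> y <= 1 / 2 -> f 0 <= f y.
  apply: (@ger0_derive1_ndecr _ f 0 (1 / 2) _ _ _ 0 y (lexx _)) => [x _|x|].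
  - exact: ex_derive.
  - rewrite in_itv/= => /andP[x0 x1].
    rewrite derive1E derive_val subr_ge0.
    have e : 1 - x <= expR (- x) by have := expR_ge1Dx (- x).
    rewrite -[x in expR x]opprK expRN.
    have x1' : 0 < 1 - x by lra.
    apply: (@le_trans _ _ (1 - x)^-1); first by rewrite lef_pV2// posrE expR_gt0.
    rewrite -div1r ler_pdivrMr//; nra.
  - apply: continuous_subspaceT => x.
    by apply: differentiable_continuous; apply/derivable1_diffP; exact: ex_derive.
by rewrite /f expR0 !expr0n/=; lra.
Qed.

Lemma expR_le_taylor2 y : `|y| <= 1 / 2 ->
  expR y <= 1 + y + y ^+ 2 / 2 + `|y| ^+ 3.
Proof.
have [y0|y0] := leP 0 y.
  by rewrite (ger0_norm y0) => yh; apply: expR_le_cubic; rewrite y0.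
move=> _; have := expR_le_quadratic (ltW y0).
by have := exprn_ge0 3 (normr_ge0 y); lra.
Qed.

Lemma mul_expR_ge_taylor2 y : y + y ^+ 2 - `|y| ^+ 3 / 2 <= y * expR y.
Proof.
have [y0|y0] := leP 0 y.
  rewrite (ger0_norm y0); have := expR_ge1Dx y.
  have := exprn_ge0 3 y0; nra.
rewrite (ltr0_norm y0); have := expR_le_quadratic (ltW y0).
rewrite -(ler_nM2l y0) => h; apply: le_trans h.
by rewrite le_eqVlt; apply/orP; left; apply/eqP; field.
Qed.

Lemma mul_expR_ge y : y <= y * expR y.
Proof.
have [y0|y0] := leP 0 y.
  by rewrite ler_peMr// -expR0 ler_expR.
by move: (y0); rewrite -expR_lt1; nra.
Qed.

End exponential_bounds.

(** * Weighted averages of bounded functions *)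

Section weighted_average.
Context {R : realType} {disp} {S : measurableType disp}.
Variables (mu : {measure set S -> \bar R}) (E : set S).

Definition bounded_measurable (f : S -> R) :=
  measurable_fun E f /\ exists M : R, forall z, E z -> `|f z| <= M.

(** A bound away from 0 survives products and makes the normalizing integral positive by comparison
    with a constant. *)
Definition positive_weight (w : S -> R) :=
  bounded_measurable w /\ exists2 c : R, 0 < c & forall z, E z -> c <= w z.

(** Expectation under the density proportional to [w]. With [w] unnormalized, a Hedge update is a
    product of weights. *)
Definition wavg (w f : S -> R) : R :=
  (\int[mu]_(z in E) (w z * f z)) / \int[mu]_(z in E) w z.

Lemma bounded_measurable_cst (c : R) : bounded_measurable (fun=> c).
Proof. by split; [exact: measurable_cst|exists `|c|]. Qed.

Lemma bounded_measurable_indic (A : set S) : measurable A ->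
  bounded_measurable (\1_A : S -> R).
Proof.
move=> mA; split; first by apply: measurable_funTS; exact: measurable_indic.
by exists 1 => z _; rewrite indicE; case: (_ \in _); rewrite ?normr1 ?normr0.
Qed.

Lemma bounded_measurableD f g : bounded_measurable f -> bounded_measurable g ->
  bounded_measurable (fun z => f z + g z).
Proof.
move=> [mf [M fM]] [mg [N gN]]; split; first exact: measurable_funD.
exists (M + N) => z Ez; rewrite (le_trans (ler_normD _ _))//.
by rewrite lerD ?fM ?gN.
Qed.

Lemma bounded_measurableM f g : bounded_measurable f -> bounded_measurable g ->
  bounded_measurable (fun z => f z * g z).
Proof.
move=> [mf [M fM]] [mg [N gN]]; split; first exact: measurable_funM.
by exists (M * N) => z Ez; rewrite normrM ler_pM ?fM ?gN.
Qed.

Lemma bounded_measurableZ (c : R) f : bounded_measurable f ->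
  bounded_measurable (fun z => c * f z).
Proof. exact/bounded_measurableM/bounded_measurable_cst. Qed.

Lemma bounded_measurable_sum (I : eqType) (s : seq I) (f : I -> S -> R) :
  (forall i, i \in s -> bounded_measurable (f i)) ->
  bounded_measurable (fun z => \sum_(i <- s) f i z).
Proof.
elim: s => [|i s IHs] bf.
  by under eq_fun do rewrite big_nil; exact: bounded_measurable_cst.
under eq_fun do rewrite big_cons.
apply: bounded_measurableD; first by apply: bf; rewrite mem_head.
by apply: IHs => j js; apply: bf; rewrite in_cons js orbT.
Qed.

Lemma bounded_measurable_norm f : bounded_measurable f ->
  bounded_measurable (fun z => `|f z|).
Proof.
move=> [mf [M fM]]; split; first exact: measurableT_comp.
by exists M => z Ez; rewrite normr_id fM.
Qed.

Lemma bounded_measurable_expR f : bounded_measurable f ->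
  bounded_measurable (fun z => expR (f z)).
Proof.
move=> [mf [M fM]]; split; first exact: measurableT_comp.
exists (expR M) => z Ez; rewrite ger0_norm ?expR_ge0// ler_expR.
by rewrite (le_trans (ler_norm _))// fM.
Qed.

Lemma positive_weight_expR f : bounded_measurable f ->
  positive_weight (fun z => expR (f z)).
Proof.
move=> bf; split; first exact: bounded_measurable_expR.
have [_ [M fM]] := bf; exists (expR (- M)); first exact: expR_gt0.
move=> z Ez; rewrite ler_expR; have := fM z Ez.
by rewrite ler_norml => /andP[].
Qed.

Lemma positive_weightM v w : positive_weight v -> positive_weight w ->
  positive_weight (fun z => v z * w z).
Proof.
move=> [bv [a a0 av]] [bw [b b0 bbw]]; split; first exact: bounded_measurableM.
exists (a * b); first exact: mulr_gt0.
by move=> z Ez; rewrite ler_pM ?(ltW a0) ?(ltW b0)// ?av ?bbw.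
Qed.

Hypotheses (mE : measurable E) (E0 : (0 < mu E)%E) (Eoo : (mu E < +oo)%E).

Lemma bounded_measurable_integrable f : bounded_measurable f ->
  mu.-integrable E (EFin \o f).
Proof.
move=> [mf [M fM]]; apply: measurable_bounded_integrable => //.
exists M; split; first exact: num_real.
by move=> x Mx z Ez; rewrite /= (le_trans (fM _ Ez))// ltW.
Qed.

Let bint := bounded_measurable_integrable.

Lemma Rintegral_weight_gt0 w : positive_weight w ->
  0 < \int[mu]_(z in E) w z.
Proof.
move=> [bw [c c0 cw]]; apply: (@lt_le_trans _ _ (\int[mu]_(z in E) c)).
  by rewrite Rintegral_cst// mulr_gt0// fine_gt0// E0 Eoo.
by apply: le_Rintegral => //; apply: bint => //; exact: bounded_measurable_cst.
Qed.

Section fixed_weight.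
Variable w : S -> R.
Hypothesis pw : positive_weight w.

Let bw : bounded_measurable w. Proof. by case: pw. Qed.

Let W0 : \int[mu]_(z in E) w z != 0.
Proof. by rewrite gt_eqF// Rintegral_weight_gt0. Qed.

Let bintw f : bounded_measurable f ->
  mu.-integrable E (EFin \o (fun z => w z * f z)).
Proof. by move=> bf; apply/bint/bounded_measurableM. Qed.

Lemma wavg_cst c : wavg w (fun=> c) = c.
Proof.
rewrite /wavg (RintegralZr c mE (bint bw)).
by rewrite mulrAC divff// mul1r.
Qed.

Lemma wavgD f g : bounded_measurable f -> bounded_measurable g ->
  wavg w (fun z => f z + g z) = wavg w f + wavg w g.
Proof.
move=> bf bg; rewrite /wavg -mulrDl -RintegralD//; [|exact: bintw..].
by congr (_ / _); apply: eq_Rintegral => z _; rewrite mulrDr.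
Qed.

Lemma wavgZ c f : bounded_measurable f ->
  wavg w (fun z => c * f z) = c * wavg w f.
Proof.
move=> bf; rewrite /wavg mulrA -RintegralZl//; last exact: bintw.
by congr (_ / _); apply: eq_Rintegral => z _; rewrite mulrCA.
Qed.

Lemma wavg_sum (I : eqType) (s : seq I) (f : I -> S -> R) :
  (forall i, bounded_measurable (f i)) ->
  wavg w (fun z => \sum_(i <- s) f i z) = \sum_(i <- s) wavg w (f i).
Proof.
move=> bf; elim: s => [|i s IHs].
  by under eq_fun do rewrite big_nil; rewrite big_nil wavg_cst.
under eq_fun do rewrite big_cons.
by rewrite wavgD// ?IHs ?big_cons//; exact: bounded_measurable_sum.
Qed.

Lemma le_wavg f g : bounded_measurable f -> bounded_measurable g ->
  (forall z, E z -> f z <= g z) -> wavg w f <= wavg w g.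
Proof.
move=> bf bg fg; rewrite /wavg ler_pM2r ?invr_gt0 ?Rintegral_weight_gt0//.
apply: le_Rintegral => //; [exact: bintw..|] => z Ez.
have [_ [c c0 cw]] := pw.
by rewrite ler_wpM2l ?fg// (le_trans (ltW c0))// cw.
Qed.

Lemma wavg_le f c : bounded_measurable f ->
  (forall z, E z -> f z <= c) -> wavg w f <= c.
Proof.
by move=> bf fc; rewrite -[leRHS]wavg_cst le_wavg//; exact: bounded_measurable_cst.
Qed.

Lemma wavg_ge f c : bounded_measurable f ->
  (forall z, E z -> c <= f z) -> c <= wavg w f.
Proof.
by move=> bf fc; rewrite -[leLHS]wavg_cst le_wavg//; exact: bounded_measurable_cst.
Qed.

(** Change of measure: tilting by [v] multiplies the integrand by [v] and divides by its
    expectation. *)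
Lemma wavg_weightM v f :
  positive_weight v -> bounded_measurable f ->
  wavg (fun z => w z * v z) f = wavg w (fun z => v z * f z) / wavg w v.
Proof.
move=> [bv _] bf; rewrite /wavg invf_div mulrA divfK//.
by congr (_ / _); apply: eq_Rintegral => z _; rewrite mulrA.
Qed.

Lemma eq_wavg f g : (forall z, E z -> f z = g z) -> wavg w f = wavg w g.
Proof.
move=> fg; congr (_ / _); apply: eq_Rintegral => z /[!inE] Ez.
by rewrite fg.
Qed.

End fixed_weight.

(* The trapezoid rule for the cumulant generating function, whose third
   derivative is bounded by the cube of the range. *)
Lemma ln_wavg_expR_trapezoid w X (e : R) :
  positive_weight w -> bounded_measurable X ->
  (forall z, E z -> `|X z| <= e) ->
  ln (wavg w (fun z => expR (X z))) <=
  (wavg w X + wavg (fun z => w z * expR (X z)) X) / 2 + 32 * e ^+ 3.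
Proof.
move=> pw bX Xe.
have pwX : positive_weight (fun z => w z * expR (X z)).
  by apply: positive_weightM => //; exact: positive_weight_expR.
have XleN z : E z -> - e <= X z.
  by move=> Ez; have := Xe z Ez; rewrite ler_norml => /andP[].
have Xle z : E z -> X z <= e.
  by move=> Ez; have := Xe z Ez; rewrite ler_norml => /andP[].
have e0 : 0 <= e.
  have := le_trans (wavg_ge pw bX XleN) (wavg_le pw bX Xle); lra.
have ale : wavg w X <= e by exact: wavg_le.
have age : - e <= wavg w X by exact: wavg_ge.
have bleN : - e <= wavg (fun z => w z * expR (X z)) X by exact: wavg_ge.
have bexp := bounded_measurable_expR.
(* For large [e] crude bounds suffice: the logarithm is at most [e], both means are at least [- e],
   and [2 * e <= 32 * e ^+ 3]. *)
have [e1|e1] := ltP (1 / 4) e.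
  have : ln (wavg w (fun z => expR (X z))) <= e.
    rewrite -[leRHS]expRK ler_ln ?posrE ?expR_gt0//.
      apply: wavg_le => //; first exact: bexp.
      by move=> z Ez; rewrite ler_expR Xle.
    apply: lt_le_trans (expR_gt0 (- e)) _.
    apply: wavg_ge => //; first exact: bexp.
    by move=> z Ez; rewrite ler_expR XleN.
  have : e * (1 / 4 * (1 / 4)) <= e * e ^+ 2.
    by rewrite ler_wpM2l// expr2 ler_pM//; lra.
  rewrite -exprS; lra.
(* Centring at the mean removes the first-order terms and at most doubles the range. *)
set a := wavg w X in ale age *.
pose Y z := X z - a.
have bY : bounded_measurable Y.
  by apply: bounded_measurableD => //; exact: bounded_measurable_cst.
have Ye z : E z -> `|Y z| <= 2 * e.
  by move=> Ez; rewrite ler_norml /Y; have := Xle z Ez; have := XleN z Ez; lra.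
have bYe := bexp _ bY.
have bYY : bounded_measurable (fun z => Y z ^+ 2) by exact: bounded_measurableM.
have bYYY : bounded_measurable (fun z => `|Y z| ^+ 3).
  rewrite (_ : (fun _ => _) = fun z => `|Y z| * (`|Y z| * `|Y z|)); last first.
    by apply/funext => z; rewrite !exprS expr0 mulr1.
  by do 2 (apply: bounded_measurableM; first exact: bounded_measurable_norm);
    exact: bounded_measurable_norm.
have EY : wavg w Y = 0.
  rewrite wavgD//; last exact: bounded_measurable_cst.
  by rewrite (wavg_cst pw) subrr.
(* With [N / M] the tilted mean of [Y], the goal will become [ln M <= N / (2 * M) + 32 * e ^+ 3]. *)
set M := wavg w (fun z => expR (Y z)).
set v := wavg w (fun z => Y z ^+ 2).
set q := wavg w (fun z => `|Y z| ^+ 3).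
set N := wavg w (fun z => Y z * expR (Y z)).
have MX : wavg w (fun z => expR (X z)) = expR a * M.
  by rewrite -wavgZ//; apply: eq_wavg => z _; rewrite -expRD /Y addrC subrK.
have M1 : 1 <= M.
  rewrite -[leLHS]addr0 -EY -[X in X + _](wavg_cst pw) -wavgD//; last first.
    exact: bounded_measurable_cst.
  apply: le_wavg => //; last by move=> z _; exact: expR_ge1Dx.
  by apply: bounded_measurableD => //; exact: bounded_measurable_cst.
have M0 : 0 < M by lra.
have bN : bounded_measurable (fun z => Y z * expR (Y z)).
  exact: bounded_measurableM.
have -> : wavg (fun z => w z * expR (X z)) X = a + N / M.
  rewrite (@eq_wavg _ X (fun z => a + Y z)); last first.
    by move=> z _; rewrite /Y addrC subrK.
  rewrite wavgD//; last exact: bounded_measurable_cst.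
  rewrite wavg_cst//; congr (_ + _).
  rewrite (wavg_weightM pw (positive_weight_expR bX) bY).
  rewrite MX (_ : wavg w _ = expR a * N).
    by rewrite -mulf_div divff ?mul1r// gt_eqF// expR_gt0.
  rewrite -wavgZ//; apply: eq_wavg => z _.
  rewrite (_ : expR (X z) = expR a * expR (Y z)); first by ring.
  by rewrite -expRD /Y addrC subrK.
(* Taylor expansion gives [M - 1 <= v / 2 + q] and [N >= v - q / 2]. The variance [v] cancels in
   [M - 1 - N / 2], leaving terms of order [e ^+ 3]. *)
rewrite MX lnM ?posrE ?expR_gt0// expRK.
have lnM1 : ln M <= M - 1.
  by rewrite -[in ln M](subrKC 1 M) le_ln1Dx//; lra.
have b1 : bounded_measurable (fun=> 1) by exact: bounded_measurable_cst.
have b2 := bounded_measurableZ 2^-1 bYY.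
have b3 := bounded_measurableD (bounded_measurableD b1 bY) b2.
have Mle : M <= 1 + v / 2 + q.
  have -> : 1 + v / 2 + q =
      wavg w (fun z => 1 + Y z + 2^-1 * Y z ^+ 2 + `|Y z| ^+ 3).
    rewrite (wavgD pw b3 bYYY).
    rewrite (wavgD pw (bounded_measurableD b1 bY) b2).
    rewrite (wavgD pw b1 bY) EY (wavgZ pw _ bYY) (wavg_cst pw).
    by rewrite -/v -/q; ring.
  apply: le_wavg => //; first exact: bounded_measurableD.
  move=> z Ez; rewrite [2^-1 * _]mulrC; apply: expR_le_taylor2.
  by have := Ye z Ez; lra.
have b4 := bounded_measurableZ (- 2^-1) bYYY.
have b5 := bounded_measurableD bY bYY.
have Nge : v - q / 2 <= N.
  have -> : v - q / 2 = wavg w (fun z => Y z + Y z ^+ 2 + - 2^-1 * `|Y z| ^+ 3).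
    rewrite (wavgD pw b5 b4) (wavgD pw bY bYY) EY.
    by rewrite (wavgZ pw _ bYYY) -/v -/q; ring.
  apply: le_wavg => //; first exact: bounded_measurableD.
  by move=> z _; have := mul_expR_ge_taylor2 (Y z); lra.
have N0 : 0 <= N.
  by rewrite -EY; apply: le_wavg => // z _; exact: mul_expR_ge.
have NleM : N <= 2 * e * M.
  rewrite -wavgZ//; apply: le_wavg => //; first exact: bounded_measurableZ.
  move=> z Ez; rewrite ler_wpM2r ?expR_ge0//.
  by rewrite (le_trans (ler_norm _))// Ye.
have vle : v <= 4 * e ^+ 2.
  apply: wavg_le => // z Ez; rewrite -real_normK ?num_real//.
  rewrite (_ : 4 * e ^+ 2 = (2 * e) ^+ 2); last by ring.
  by rewrite ler_sqr ?nnegrE ?Ye// mulr_ge0.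
have qle : q <= 8 * e ^+ 3.
  apply: wavg_le => // z Ez.
  rewrite (_ : 8 * e ^+ 3 = (2 * e) ^+ 3); last by ring.
  by rewrite lerXn2r ?nnegrE ?Ye// mulr_ge0.
(* Replacing [N / M] by [N] costs at most [N * (M - 1)], which is shown below to be at most
   [16 * e ^+ 3]. *)
have NM : N - N * (M - 1) <= N / M.
  rewrite ler_pdivlMr// (_ : _ * M = N - N * (M - 1) ^+ 2); last by ring.
  by rewrite gerBl mulr_ge0// sqr_ge0.
have e2 : 0 <= e ^+ 2 by rewrite sqr_ge0.
have e2le : e ^+ 2 <= 1 / 4 * (1 / 4) by rewrite expr2 ler_pM.
have e3 : e ^+ 3 = e * e ^+ 2 by rewrite exprS.
have e3le : e ^+ 3 <= 1 / 4 * e ^+ 2 by rewrite e3 ler_wpM2r.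
have M2 : M - 1 <= 4 * e ^+ 2 by lra.
have Mle2 : M <= 2 by lra.
have : N * (M - 1) <= (4 * e) * (4 * e ^+ 2).
  apply: ler_pM => //; first by lra.
  apply: (le_trans NleM); rewrite (_ : 4 * e = 2 * e * 2); last by ring.
  by rewrite ler_wpM2l// mulr_ge0.
have : 0 <= e ^+ 3 by rewrite exprn_ge0.
rewrite (_ : 4 * e * _ = 16 * e ^+ 3); last by rewrite e3; ring.
lra.
Qed.

End weighted_average.

(** * Lebesgue measure on rows *)

Import HBNNSimple.

Section integral_null.
Local Open Scope ereal_scope.
Context {R : realType} {disp} {S : measurableType disp}.
Variable mu : {measure set S -> \bar R}.

Let ge0_integral_setD_null (N : set S) (f : S -> \bar R) :
  measurable N -> mu N = 0 -> (forall x, 0 <= f x) ->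
  \int[mu]_x f x = \int[mu]_(x in ~` N) f x.
Proof.
move=> mN N0 f0; rewrite ge0_integralTE// ge0_integralE//.
apply/eqP; rewrite eq_le; apply/andP; split; last first.
  apply: le_ereal_sup => _ [h /= hf <-]; exists h => // x.
  by rewrite (le_trans (hf x))// patchE; case: ifP.
apply: ge_ereal_sup => _ [h /= hf <-].
apply: ereal_sup_ubound; exists (proj_nnsfun h (measurableC mN)) => /=.
  move=> x; rewrite /= patchE mindicE; case: ifP => xN; rewrite ?mulr1//.
  by rewrite mulr0.
rewrite -mrestrict -integralT_nnsfun// -[LHS]integral_nnsfun//; last exact: measurableC.
rewrite -setTD -(@ge0_negligible_integral _ _ _ mu setT N)//; last first.
  by move=> x _; rewrite lee_fin.
exact/measurable_EFinP.
Qed.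

(* Convex losses may be non-measurable on the boundary of the domain, hence an
   arbitrary f. The integral of a nonnegative function is a supremum over the
   simple functions below it, and these may be set to 0 on N. *)
Lemma integral_setD_null (D N : set S) (f : S -> \bar R) :
  measurable N -> mu N = 0 ->
  \int[mu]_(x in D) f x = \int[mu]_(x in D `\` N) f x.
Proof.
move=> mN N0; rewrite setDE.
rewrite [LHS]integralE [RHS]integralE; congr (_ - _);
  rewrite [RHS]integral_mkcondl [LHS]integral_mkcond;
  by rewrite (@ge0_integral_setD_null N)// => x; rewrite patchE; case: ifP.
Qed.

End integral_null.

(** * Coordinates and the sup norm *)

Section row_norm.
Context {R : realType} {n : nat}.
Implicit Types v w : 'rV[R]_n.

Lemma coord_le_norm v i : `|v ord0 i| <= `|v|.
Proof.
rewrite [leRHS]/Num.norm/= mx_normrE.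
by rewrite (le_bigmax _ (fun ij : 'I_1 * 'I_n => `|v ij.1 ij.2|) (ord0, i)).
Qed.

Lemma row_norm_lt v (e : R) : 0 < e -> (forall i, `|v ord0 i| < e) -> `|v| < e.
Proof.
move=> e0 ve; rewrite [ltLHS]/Num.norm/= mx_normrE.
by apply/bigmax_ltP; split => // -[i j] _ /=; rewrite ord1.
Qed.

Lemma row_norm_le v (e : R) : 0 <= e -> (forall i, `|v ord0 i| <= e) -> `|v| <= e.
Proof.
move=> e0 ve; rewrite [leLHS]/Num.norm/= mx_normrE.
by apply/bigmax_leP; split => // -[i j] _ /=; rewrite ord1.
Qed.

End row_norm.

(** * Measurability of boxes, open sets and closed sets *)

Section measurable_open_row.
Context {R : realType} {n : nat}.

Lemma measurable_box (A : 'I_n -> set (measurableTypeR R)) :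
  (forall i, measurable (A i)) ->
  measurable [set v : 'rV[R]_n | forall i, A i (v ord0 i)].
Proof.
move=> mA; rewrite (_ : [set _ | _] = \bigcap_(i in [set: 'I_n])
    (fun v : 'rV[R]_n => v ord0 i) @^-1` A i).
  apply: fin_bigcap_measurable; first exact: finite_finset.
  move=> i _; rewrite -[X in measurable X]setTI.
  exact: (measurable_coor i measurableT (mA _)).
by apply/seteqP; split => v /= Bv i; [move=> _|]; exact: Bv.
Qed.

(** An open set is the union of the boxes with rational centre and radius [1 / (k + 1)] that it
    contains, a countable family. *)
Lemma open_measurable_row (A : set 'rV[R]_n) : open A -> measurable A.
Proof.
move=> oA.
pose B (p : 'rV[rat]_n * nat) := [set v : 'rV[R]_n |
  forall i, ball (ratr (p.1 ord0 i) : R) p.2.+1%:R^-1 (v ord0 i)].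
pose F p := if `[< B p `<=` A >] then B p else set0.
suff -> : A = \bigcup_p F p.
  apply: countable_bigcupT_measurable => [|p].
    exact: (@countableP (('rV[rat]_n * nat)%type : countType)).
  rewrite /F; case: asboolP => // _.
  apply: (@measurable_box (fun i => ball (ratr (p.1 ord0 i) : R) p.2.+1%:R^-1)).
  by move=> i; exact: measurable_ball.
apply/seteqP; split=> [v Av|v [p _]]; last first.
  by rewrite /F; case: asboolP => // BA; exact: BA.
have /nbhs_ballP[e /= e0 veA] : nbhs v A by exact: open_nbhs_nbhs.
(* A box of radius below [e / 2] that contains [v] lies within [e] of [v]. *)
have [k _ ke] := near_infty_natSinv_lt (PosNum (divr_gt0 e0 (ltr0Sn R 1))).
have {ke} ke : k.+1%:R^-1 < e / 2 by exact: (ke k (leqnn _)).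
have k0 : 0 < k.+1%:R^-1 :> R by rewrite invr_gt0.
have /choice[q qP] (i : 'I_n) : exists r : rat, `|ratr r - v ord0 i| < k.+1%:R^-1.
  have /rat_in_itvoo[r] : v ord0 i - k.+1%:R^-1 < v ord0 i by rewrite ltrBlDr ltrDl.
  rewrite in_itv/= => /andP[vr rv]; exists r.
  by rewrite ltr_norml ltrBrDr addrC vr/= ltrBlDr (lt_trans rv)// ltrDr.
exists (\row_i q i, k) => //; rewrite /F.
have Bv : B (\row_i q i, k) v by move=> i /=; rewrite mxE; exact: qP.
rewrite asboolT // => w Bw; apply: veA.
rewrite -ball_normE /=; apply: row_norm_lt => // i.
have := Bw i; have := qP i; rewrite /= !mxE /ball/=.
move: ke; set a := _^-1; set r := ratr _; move: a r => a r ae h1 h2.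
rewrite (_ : _ - _ = - (r - v ord0 i) + (r - w ord0 i)); last by ring.
by rewrite (le_lt_trans (ler_normD _ _))// normrN; lra.
Qed.

Lemma closed_measurable_row (A : set 'rV[R]_n) : closed A -> measurable A.
Proof.
move=> cA; rewrite -[A]setCK; apply: measurableC.
by apply: open_measurable_row; exact: closed_openC.
Qed.

End measurable_open_row.

(** * Lebesgue measure under affine maps *)

Section lebesgue_affine.
Context {R : realType}.
Local Open Scope ereal_scope.

(** Uniqueness of Lebesgue measure: the rescaled pushforward [m2] has the same values on half-open
    intervals. *)
Lemma lebesgue_measure_affine (b c : R) (A : set (measurableTypeR R)) :
  (0 < c)%R -> measurable A ->
  lebesgue_measure A =
  c%:E * lebesgue_measure ((fun x : measurableTypeR R => b + c * x)%R @^-1` A).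
Proof.
move=> c0 mA.
have mg : measurable_fun [set: measurableTypeR R]
    (fun x : measurableTypeR R => (b + c * x)%R : measurableTypeR R).
  by apply: measurable_funD => //; exact: measurable_funM.
pose m2 : {measure set (measurableTypeR R) -> \bar R} :=
  mscale (NngNum (ltW c0))
    (measure_function_pushforward__canonical__measure_function_Measure
      lebesgue_measure mg).
rewrite (@lebesgue_measure_unique _ m2) // => _ [[p q] /= _ <-].
rewrite /m2 /= /mscale/= /pushforward.
rewrite (_ : _ @^-1` _ = `](p - b) / c, (q - b) / c]%classic)%R; last first.
  apply/seteqP; split => x /=; rewrite !in_itv/= ltr_pdivrMr// ler_pdivlMr//;
  by move=> /andP[? ?]; apply/andP; split; lra.
rewrite !lebesgue_measure_itv/= !lte_fin ltr_pM2r ?invr_gt0// ltrD2r.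
case: ifP => _; last by rewrite mule0.
by rewrite -!EFinD -EFinM; congr EFin; field; rewrite gt_eqF.
Qed.

Lemma measurable_affine_row n (b : 'rV[R]_n) (c : R) :
  measurable_fun [set: 'rV[R]_n] (fun z : 'rV[R]_n => b + c *: z)%R.
Proof.
apply: measurable_fun_row => i; under eq_fun do rewrite !mxE.
apply: measurable_funD => //; apply: measurable_funM => //.
exact: measurable_coor.
Qed.

(** Both sides are measures, so they need only agree on boxes, which are stable under intersection,
    generate the sigma-algebra and include the cubes [g k] of finite volume that cover the space. On
    boxes the claim splits into coordinates. *)
Lemma lebesgue_row_affine n (b : 'rV[R]_n) (c : R) (A : set 'rV[R]_n) :
  (0 < c)%R -> measurable A ->
  lebesgue_row n A =
  (c ^+ n)%:E * lebesgue_row n ((fun z : 'rV[R]_n => b + c *: z)%R @^-1` A).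
Proof.
move=> c0 mA.
have cn0 : (0 <= c ^+ n)%R by rewrite exprn_ge0// ltW.
pose m2 : {measure set 'rV[R]_n -> \bar R} :=
  mscale (NngNum cn0)
    (measure_function_pushforward__canonical__measure_function_Measure
      (lebesgue_row n) (measurable_affine_row b c)).
pose G := [set [set v : 'rV[R]_n | forall i, B i (v ord0 i)] |
  B in [set B : 'I_n -> set (measurableTypeR R) | forall i, measurable (B i)]].
pose g (k : nat) := [set v : 'rV[R]_n | forall i,
  (fun=> `[(- k%:R)%R, k%:R]%classic : set (measurableTypeR R)) i (v ord0 i)].
have coverg : \bigcup_k (g k) = setT.
  apply/seteqP; split=> // v _.
  exists (Num.bound `|v|) => // i /=; rewrite in_itv/= -ler_norml.
  by rewrite (le_trans (coord_le_norm _ _))// ltW// archi_boundP.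
rewrite (measure_unique G g _ _ _ coverg _ m2)//.
- apply/seteqP; split.
    apply: smallest_sub; first exact: smallest_sigma_algebra.
    rewrite -bigcup_seq => _ [i _ [B mB <-]].
    apply: sub_sigma_algebra.
    exists (fun j => if j == i then B else setT).
      by move=> j; case: ifP.
    rewrite setTI; apply/seteqP; split=> v /=.
      by move=> /(_ i); rewrite eqxx.
    by move=> Bv j; case: eqP => // ->.
  apply: smallest_sub; first exact: sigma_algebra_measurable.
  by move=> _ [B mB <-]; exact: measurable_box.
- move=> _ _ [B mB <-] [B' mB' <-]; exists (fun i => B i `&` B' i).
    by move=> i; exact: measurableI.
  apply/seteqP; split => v /=; first by move=> BB'; split=> i; have [] := BB' i.
  by move=> [Bv B'v] i; split.
- by move=> k; exists (fun=> `[(- k%:R)%R, k%:R]%classic).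
- move=> _ [B mB <-]; apply: (etrans (lebesgue_row_box mB)).
  rewrite /m2/= /mscale/= /pushforward.
  pose B' i := (fun x : measurableTypeR R => b ord0 i + c * x)%R @^-1` B i.
  have mB' i : measurable (B' i).
    rewrite -[X in measurable X]setTI.
    have mg : measurable_fun [set: measurableTypeR R]
        (fun x : measurableTypeR R => (b ord0 i + c * x)%R : measurableTypeR R).
      by apply: measurable_funD => //; exact: measurable_funM.
    exact: mg.
  rewrite (_ : _ @^-1` _ = [set v : 'rV[R]_n | forall i, B' i (v ord0 i)]).
    rewrite (lebesgue_row_box mB') (_ : (c ^+ n)%:E = \prod_(i < n) c%:E).
      rewrite -big_split/=; apply: eq_bigr => i _.
      exact: lebesgue_measure_affine.
    by rewrite prodEFin prodr_const card_ord.
  by apply/seteqP; split => v /= Bv i; have := Bv i; rewrite /B'/= !mxE.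
- move=> k; rewrite (_ : _ (g k) =
      \prod_(i < n) lebesgue_measure `[(- k%:R)%R, k%:R]%classic); last first.
    exact: (@lebesgue_row_box R n (fun=> `[(- k%:R)%R, k%:R]%classic)
      (fun=> measurable_itv _)).
  rewrite (_ : (\prod_(i < n) _) = \prod_(i < n) (k%:R + k%:R)%:E).
    by rewrite prodEFin ltry.
  apply: eq_bigr => i _; rewrite lebesgue_measure_itv/= lte_fin.
  have [->|k0] := eqVneq k 0%N; first by rewrite oppr0 ltxx addr0.
  by rewrite gtrN ?ltr0n ?lt0n// -EFinB opprK.
Qed.

End lebesgue_affine.

(** * Convex bodies *)

Section convexity.
Context {R : realType} {d : nat}.
Implicit Types (X : set 'rV[R]_d) (f : 'rV[R]_d -> R).

Definition convex_body X := [/\ compact X,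
  convex_set (X : set (convex_lmodType 'rV[R]_d)) & X° !=set0].

Lemma convex_setE X (a b : 'rV[R]_d) (t : R) :
  convex_set (X : set (convex_lmodType 'rV[R]_d)) ->
  X a -> X b -> 0 <= t -> t <= 1 -> X (t *: a + (1 - t) *: b).
Proof.
move=> cX /mem_set Xa /mem_set Xb t0 t1.
have := cX a b (Itv01 t0 t1) Xa Xb.
by rewrite inE.
Qed.

Lemma convex_functionE X f (a b : 'rV[R]_d) (t : R) :
  convex_function (X : set (convex_lmodType 'rV[R]_d)) f ->
  X a -> X b -> 0 <= t -> t <= 1 ->
  f (t *: a + (1 - t) *: b) <= t * f a + (1 - t) * f b.
Proof.
move=> cf /mem_set Xa /mem_set Xb t0 t1.
exact: (cf (Itv01 t0 t1) a b Xa Xb).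
Qed.

Lemma interior_ballP X y : X° y <->
  exists2 r : R, 0 < r & forall z : 'rV[R]_d, `|z - y| < r -> X z.
Proof.
split=> [/nbhs_ballP[r /= r0 yrX]|[r r0 yrX]].
  by exists r => // z zy; apply: yrX; rewrite -ball_normE/= distrC.
apply/nbhs_ballP; exists r => //= z; rewrite -ball_normE/= distrC.
exact: yrX.
Qed.

(** The homothety of centre [x] and ratio [t] keeps [X] inside itself and carries a ball about [y]
    to a ball about the combination. *)
Lemma convex_interior X (y x : 'rV[R]_d) (t : R) :
  convex_set (X : set (convex_lmodType 'rV[R]_d)) ->
  X° y -> X x -> 0 < t -> t <= 1 -> X° (t *: y + (1 - t) *: x).
Proof.
move=> cX /interior_ballP[r r0 yrX] Xx t0 t1; apply/interior_ballP.
exists (t * r) => [|w]; first exact: mulr_gt0.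
set p := t *: y + _ => wp.
have -> : w = t *: (y + t^-1 *: (w - p)) + (1 - t) *: x.
  rewrite scalerDr scalerA divff ?gt_eqF// scale1r addrAC -/p.
  by rewrite subrKC.
apply: convex_setE => //; last exact: ltW.
apply: yrX; rewrite addrC addKr normrZ gtr0_norm ?invr_gt0//.
by rewrite mulrC ltr_pdivrMr// mulrC.
Qed.

(** * Continuity of a bounded convex function at an interior point *)

Section continuity.
Variables (X : set 'rV[R]_d) (f : 'rV[R]_d -> R).
Hypotheses (cf : convex_function (X : set (convex_lmodType 'rV[R]_d)) f)
  (f1 : forall z, X z -> -1 <= f z <= 1).
Variables (y : 'rV[R]_d) (r : R).
Hypotheses (r0 : 0 < r) (yrX : forall z : 'rV[R]_d, `|z - y| < r -> X z).

(** Stretching [w - y] by [1 / e] reaches a point [z] of [X], and convexity on the segment gives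
    [f w - f y <= e * (f z - f y)]. *)
Lemma convex_upper_bound (w : 'rV[R]_d) (e : R) :
  0 < e -> e <= 1 -> `|w - y| < e * r -> f w <= f y + 2 * e.
Proof.
move=> e0 e1 wy; pose z := y + e^-1 *: (w - y).
have Xz : X z.
  apply: yrX; rewrite addrC addKr normrZ gtr0_norm ?invr_gt0//.
  by rewrite mulrC ltr_pdivrMr// mulrC.
have Xy : X y by apply: yrX; rewrite subrr normr0.
have -> : w = e *: z + (1 - e) *: y.
  by apply/rowP => i; rewrite !mxE; field; rewrite gt_eqF.
apply: (le_trans (convex_functionE cf Xz Xy (ltW e0) e1)).
have /andP[_ fz] := f1 Xz; have /andP[fy _] := f1 Xy; nra.
Qed.

(** Here [z] is on the other side of [y], so that [y] is the combination of [w] and [z] with weight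
    [1 / (1 + e)] on [w]. *)
Lemma convex_lower_bound (w : 'rV[R]_d) (e : R) :
  0 < e -> e <= 1 -> `|w - y| < e * r -> f y <= f w + 2 * e.
Proof.
move=> e0 e1 wy; pose z := y - e^-1 *: (w - y).
have Xz : X z.
  apply: yrX; rewrite addrC addKr normrN normrZ gtr0_norm ?invr_gt0//.
  by rewrite mulrC ltr_pdivrMr// mulrC.
have Xy : X y by apply: yrX; rewrite subrr normr0.
have Xw : X w by apply: yrX; rewrite (lt_le_trans wy)// ger_pMl.
pose t := (1 + e)^-1.
have te : t * (1 + e) = 1 by rewrite mulVf// gt_eqF//; lra.
have t0 : 0 <= t by rewrite invr_ge0; lra.
have t1 : t <= 1 by nra.
have := convex_functionE cf Xw Xz t0 t1.
have /andP[_ fz] := f1 Xz; have /andP[fy _] := f1 Xy.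
have -> : t *: w + (1 - t) *: z = y.
  apply/rowP => i; rewrite !mxE /t; field.
  by rewrite !gt_eqF// ltr_wpDl.
nra.
Qed.

End continuity.

(** By [convex_upper_bound], the set where [f < a] is open in the interior; such sets suffice for
    measurability. *)
Lemma convex_bounded_measurable X f :
  convex_function (X : set (convex_lmodType 'rV[R]_d)) f ->
  (forall z, X z -> -1 <= f z <= 1) -> bounded_measurable X° f.
Proof.
move=> cf f1; split; last first.
  by exists 1 => z /interior_subset/f1; rewrite ler_norml.
move=> mX; apply: (measurability _ (RGenInftyO.measurableE R)) => //.
move=> _ [_ [a ->] <-]; apply: open_measurable_row.
rewrite openE => y [Xy]; rewrite /= in_itv/= => fya.
have /interior_ballP[r r0 yrX] := Xy.
pose e := Num.min 1 ((a - f y) / 4).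
have e0 : 0 < e by rewrite lt_min ltr01 divr_gt0// subr_gt0.
have e1 : e <= 1 by rewrite ge_min lexx.
have ea : e <= (a - f y) / 4 by rewrite ge_min lexx orbT.
apply/interior_ballP; exists (e * r) => [|w wy]; first exact: mulr_gt0.
split.
  apply/interior_ballP; exists (r - `|w - y|).
    by rewrite subr_gt0 (lt_le_trans wy)// ger_pMl.
  move=> z zw; apply: yrX; rewrite -(subrKA w) (le_lt_trans (ler_normD _ _))//.
  by rewrite -ltrBrDr.
rewrite /= in_itv/=; have := convex_upper_bound cf f1 r0 yrX e0 e1 wy.
by move: (f w) (f y) fya ea => fw fy fya ea h; lra.
Qed.

Lemma open_row_ball (y : 'rV[R]_d) (r : R) :
  open [set v : 'rV[R]_d | `|v - y| < r].
Proof.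
rewrite openE => v /= vy; apply/interior_ballP.
exists (r - `|v - y|) => [|z zv /=]; first by rewrite subr_gt0.
by rewrite -(subrKA v) (le_lt_trans (ler_normD _ _))// -ltrBrDr.
Qed.

Lemma lebesgue_ball_gt0 (y : 'rV[R]_d) (r : R) : 0 < r ->
  (0 < lebesgue_row d [set v : 'rV[R]_d | (`|v - y| < r)%R])%E.
Proof.
move=> r0.
pose B (i : 'I_d) : set (measurableTypeR R) :=
  `](y ord0 i - r), (y ord0 i + r)[%classic.
have mB i : measurable (B i) by exact: measurable_itv.
apply: (@lt_le_trans _ _ (lebesgue_row d
    [set v : 'rV[R]_d | forall i, B i (v ord0 i)])).
  rewrite (lebesgue_row_box mB).
  rewrite (_ : (\prod_(i < d) _)%E = (\prod_(i < d) (r + r)%:E)%E).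
    by rewrite prodEFin lte_fin prodr_gt0// => i _; rewrite addr_gt0.
  apply: eq_bigr => i _; rewrite lebesgue_measure_itv/= lte_fin.
  rewrite ifT; last by lra.
  by rewrite -EFinB; congr EFin; ring.
apply: le_measure; rewrite ?inE; first exact: measurable_box.
  by apply: open_measurable_row; exact: open_row_ball.
move=> v Bv; apply: row_norm_lt => // i; have := Bv i.
rewrite /B/= in_itv/= !mxE ltr_norml.
by move=> /andP[? ?]; apply/andP; split; lra.
Qed.

(** * Volume of a convex body and of its boundary *)

Section convex_body_measure.
Variable X : set 'rV[R]_d.
Hypothesis bX : convex_body X.

Let closed_body : closed X.
Proof. by have [cX _ _] := bX; apply: compact_closed => //; exact: norm_hausdorff. Qed.

Lemma measurable_convex_body : measurable X.
Proof. exact: closed_measurable_row. Qed.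

Lemma measurable_interior_row (A : set 'rV[R]_d) : measurable A°.
Proof. by apply: open_measurable_row; exact: open_interior. Qed.

Lemma lebesgue_convex_body_lty : (lebesgue_row d X < +oo)%E.
Proof.
have [/compact_bounded[M [_ XM]] _ _] := bX.
pose m := `|M| + 1.
have m0 : 0 < m by rewrite ltr_pwDr.
pose B (i : 'I_d) : set (measurableTypeR R) := `[(- m), m]%classic.
apply: (@le_lt_trans _ _ (lebesgue_row d
    [set v : 'rV[R]_d | forall i, B i (v ord0 i)])).
  apply: le_measure; rewrite ?inE.
  - exact: measurable_convex_body.
  - by apply: measurable_box => i; exact: measurable_itv.
  - move=> v Xv i; rewrite /B/= in_itv/= -ler_norml.
    rewrite (le_trans (coord_le_norm _ _))//; apply: XM => //.
    by rewrite /m ltr_pwDr// ler_norm.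
rewrite lebesgue_row_box; last by move=> i; exact: measurable_itv.
rewrite (_ : (\prod_(i < d) _)%E = (\prod_(i < d) (m + m)%:E)%E).
  by rewrite prodEFin ltry.
apply: eq_bigr => i _; rewrite lebesgue_measure_itv/= lte_fin.
by rewrite gtrN// -EFinB opprK.
Qed.

Lemma lebesgue_interior_gt0 : (0 < lebesgue_row d X°)%E.
Proof.
have [_ _ [y /interior_ballP[r r0 yrX]]] := bX.
apply: lt_le_trans (lebesgue_ball_gt0 y r0) _.
apply: le_measure; rewrite ?inE; last first.
- by rewrite -open_subsetE//; exact: open_row_ball.
- exact: measurable_interior_row.
- by apply: open_measurable_row; exact: open_row_ball.
Qed.

Lemma lebesgue_interior_lty : (lebesgue_row d X° < +oo)%E.
Proof.
apply: le_lt_trans lebesgue_convex_body_lty.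
apply: le_measure; rewrite ?inE; last exact: interior_subset.
  exact: measurable_interior_row.
exact: measurable_convex_body.
Qed.

(* Contracting X by a factor 1 - e towards an interior point maps it into its
   interior, so that (1 - e) ^ d vol(X) <= vol(X°) for every e > 0. *)
Lemma lebesgue_boundary0 : lebesgue_row d (X `\` X°) = 0%E.
Proof.
have [_ cX [y Xy]] := bX.
have mX := measurable_convex_body; have mI := measurable_interior_row X.
have IX : X° `<=` X by exact: interior_subset.
have Xoo := lebesgue_convex_body_lty; have Ioo := lebesgue_interior_lty.
rewrite measureD//; last first.
rewrite setIidr//.
have Xfin : lebesgue_row d X \is a fin_num by rewrite ge0_fin_numE.
have Ifin : lebesgue_row d X° \is a fin_num by rewrite ge0_fin_numE.
pose v := fine (lebesgue_row d X); pose w := fine (lebesgue_row d X°).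
have v0 : 0 <= v by exact: fine_ge0.
have shrink (e : R) : 0 < e -> e < 1 -> (1 - e) ^+ d * v <= w.
  move=> e0 e1; rewrite -lee_fin EFinM !fineK//.
  have c0 : 0 < 1 - e by rewrite subr_gt0.
  rewrite (lebesgue_row_affine (e *: y) c0 mI) lee_pmul2l//; last first.
    by rewrite lte_fin exprn_gt0.
  apply: le_measure; rewrite ?inE//.
    rewrite -[X in measurable X]setTI.
    exact: measurable_affine_row.
  by move=> x Xx /=; apply: convex_interior => //; exact: ltW.
have wv : w <= v by apply: fine_le => //; apply: le_measure; rewrite ?inE.
suff vw : v <= w.
  apply: (@etrans _ _ (v%:E - w%:E)%E); first by rewrite /v /w !fineK.
  by rewrite (@le_anti _ _ v w) ?vw// subee.
rewrite leNgt; apply/negP => ltwv.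
have {}v0 : 0 < v by apply: le_lt_trans ltwv; exact: fine_ge0.
have D0 : 0 < d.+1%:R :> R by rewrite ltr0n.
have w0 : 0 <= w by exact: fine_ge0.
(* This choice gives [d * e * v < (v - w) / 2], so by Bernoulli's inequality [(1 - e) ^+ d * v]
   exceeds [w], against [shrink]. *)
pose e := (v - w) / (2 * d.+1%:R * v).
have e0 : 0 < e by rewrite divr_gt0 ?subr_gt0// !mulr_gt0.
have de : d.+1%:R * e * v = (v - w) / 2.
  by rewrite /e; field; rewrite !gt_eqF.
have e1 : e < 1.
  rewrite ltr_pdivrMr ?mulr_gt0// mul1r.
  have : v <= d.+1%:R * v by rewrite ler_peMl ?(ltW v0)// ler1n.
  by rewrite -mulrA; move: (d.+1%:R * v) => q; lra.
have := shrink e e0 e1; apply/negP; rewrite -ltNge.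
have B : 1 - d%:R * e <= (1 - e) ^+ d.
  elim: d => [|k IHk]; first by rewrite mul0r subr0 expr0.
  rewrite exprS; apply: le_trans (ler_wpM2l _ IHk); last by lra.
  by rewrite -natr1; have := ler0n R k; move: (k%:R) => q q0; nra.
apply: lt_le_trans (ler_wpM2r (ltW v0) B).
have : 0 < e * v by rewrite mulr_gt0.
move: de; rewrite -natr1; move: (d%:R) => q; nra.
Qed.

End convex_body_measure.

End convexity.

(** * Means and Jensen's inequality *)

Section mean_in_convex.
Context {R : realType} {disp} {S : measurableType disp}.
Variables (mu : {measure set S -> \bar R}) (E : set S).
Hypotheses (mE : measurable E) (E0 : (0 < mu E)%E) (Eoo : (mu E < +oo)%E).
Variable w : S -> R.
Hypothesis pw : positive_weight E w.

Definition wmean n (phi : S -> 'rV[R]_n) : 'rV[R]_n :=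
  \row_i wavg mu E w (fun z => phi z ord0 i).

(** Squared Euclidean distance: the norm on rows is the sup norm, while projecting onto [K] uses an
    inner product. *)
Let sqd n (u v : 'rV[R]_n) : R := \sum_i (u ord0 i - v ord0 i) ^+ 2.

Let Enonempty : E !=set0.
Proof.
apply/set0P/eqP => EE; move: E0; rewrite EE measure0.
by rewrite ltxx.
Qed.

(* If q is a nearly closest point of K to the mean m, then m - q makes a nearly
   obtuse angle with p - q for every p in K; averaging over p = phi z bounds
   the squared distance of q to m. *)
Lemma wmean_approx n (K : set 'rV[R]_n) (phi : S -> 'rV[R]_n) (M e : R) :
  (forall a b (t : R), K a -> K b -> 0 <= t -> t <= 1 ->
    K (t *: a + (1 - t) *: b)) ->
  (forall a, K a -> `|a| <= M) ->
  (forall i, bounded_measurable E (fun z => phi z ord0 i)) ->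
  (forall z, E z -> K (phi z)) -> 0 < e ->
  exists2 q, K q & `|wmean phi - q| < e.
Proof.
move=> cK KM bphi Kphi e0; set m := wmean phi.
have [z0 Ez0] := Enonempty.
have sqd0 (u v : 'rV[R]_n) : 0 <= sqd u v by apply: sumr_ge0 => i _; exact: sqr_ge0.
suff [q Kq qm] : exists2 q, K q & sqd q m < e ^+ 2.
  exists q => //; apply: row_norm_lt => // i; rewrite !mxE.
  rewrite -ltr_sqr ?nnegrE ?(ltW e0)// real_normK ?num_real//.
  apply: le_lt_trans qm; rewrite /sqd (bigD1 i)//= mxE -sqrrN opprB.
  by rewrite lerDl sumr_ge0// => j _; exact: sqr_ge0.
pose A := [set sqd q m | q in K].
have lA : lbound A 0 by move=> _ [q _ <-].
have iA : has_inf A.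
  by split; [exists (sqd (phi z0) m); exists (phi z0) => //; exact: Kphi|exists 0].
set D := inf A.
have DA q : K q -> D <= sqd q m.
  by move=> Kq; apply: ge_inf; [exists 0|exists q].
have D0 : 0 <= D by apply: lb_le_inf => //; case: iA.
suff D_eq0 : D <= 0.
  have [_ [q Kq <-] qD] := @inf_adherent _ A (e ^+ 2) (exprn_gt0 2 e0) iA.
  by exists q => //; apply: lt_le_trans qD _; rewrite -/D; lra.
pose C := \sum_(i < n) (M + M) ^+ 2.
have C0 : 0 <= C by apply: sumr_ge0 => i _; exact: sqr_ge0.
have sqdC p q : K p -> K q -> sqd p q <= C.
  move=> Kp Kq; apply: ler_sum => i _.
  rewrite -real_normK ?num_real// lerXn2r ?nnegrE//.
    by have := le_trans (normr_ge0 _) (KM _ Kp); lra.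
  rewrite (le_trans (ler_normB _ _))// lerD// (le_trans (coord_le_norm _ _))//.
    exact: KM.
  exact: KM.
have main (t : R) : 0 < t -> t <= 1 -> D <= t * (1 + C).
  move=> t0 t1.
  have [_ [q Kq <-] qD] := @inf_adherent _ A (t ^+ 2) (exprn_gt0 2 t0) iA.
  rewrite -/D in qD.
  pose dot (p : 'rV[R]_n) := \sum_i (p ord0 i - q ord0 i) * (q ord0 i - m ord0 i).
  (* Moving from [q] a fraction [t] towards [p] stays in [K], so it lowers the squared distance to
     [m] by at most [t ^+ 2]. Expanding the square and dividing by [t] gives the bound. *)
  have dot_ge p : K p -> - (t * (1 + C)) <= 2 * dot p.
    move=> Kp; have := DA _ (cK _ _ _ Kp Kq (ltW t0) t1).
    have -> : sqd (t *: p + (1 - t) *: q) m =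
        sqd q m + t * (2 * dot p) + t ^+ 2 * sqd p q.
      rewrite /sqd /dot !mulr_sumr -!big_split/=; apply: eq_bigr => i _.
      by rewrite !mxE; ring.
    have := sqdC _ _ Kp Kq; move: (sqd p q) (sqd q m) (dot p) qD => a b c qD aC h.
    rewrite -(ler_pM2l t0).
    have : t ^+ 2 * a <= t ^+ 2 * C by rewrite ler_wpM2l// sqr_ge0.
    by rewrite (_ : t * - _ = - t ^+ 2 - t ^+ 2 * C); [lra|ring].
  have bdot : bounded_measurable E (fun z => dot (phi z)).
    apply: bounded_measurable_sum => i _; apply: bounded_measurableM.
      by apply: bounded_measurableD => //; exact: bounded_measurable_cst.
    exact: bounded_measurable_cst.
  have : - (t * (1 + C)) / 2 <= wavg mu E w (fun z => dot (phi z)).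
    apply: wavg_ge => // z Ez; have := dot_ge _ (Kphi z Ez); lra.
  (* Since [phi] averages to [m], the average is the inner product of [m - q] and [q - m]. *)
  have -> : wavg mu E w (fun z => dot (phi z)) = - sqd q m.
    rewrite /dot wavg_sum//; last first.
      move=> i; apply: bounded_measurableM; last exact: bounded_measurable_cst.
      by apply: bounded_measurableD => //; exact: bounded_measurable_cst.
    rewrite /sqd -sumrN; apply: eq_bigr => i _.
    under [X in wavg _ _ _ X]eq_fun do rewrite mulrC.
    rewrite wavgZ//; last first.
      by apply: bounded_measurableD => //; exact: bounded_measurable_cst.
    rewrite wavgD//; last exact: bounded_measurable_cst.
    rewrite wavg_cst// (_ : wavg mu E w _ = m ord0 i); last by rewrite mxE.
    by ring.
  have := DA _ Kq; have : 0 <= t * (1 + C) by rewrite mulr_ge0 ?(ltW t0)// addr_ge0.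
  lra.
have [//|Dgt0] := leP D 0.
(* With this [t], [main] would give [D <= D / 2]. *)
pose t := Num.min 1 (D / (2 * (1 + C))).
have C1 : 0 < 1 + C by rewrite ltr_wpDr.
have t0 : 0 < t by rewrite lt_min ltr01 divr_gt0// mulr_gt0.
have t1 : t <= 1 by rewrite ge_min lexx.
have : t * (1 + C) <= D / (2 * (1 + C)) * (1 + C).
  by rewrite ler_pM2r// ge_min lexx orbT.
have -> : D / (2 * (1 + C)) * (1 + C) = D / 2 by field; rewrite gt_eqF.
have := main t t0 t1; lra.
Qed.

Lemma wmean_compact n (K : set 'rV[R]_n) (phi : S -> 'rV[R]_n) :
  compact K -> convex_set (K : set (convex_lmodType 'rV[R]_n)) ->
  (forall i, bounded_measurable E (fun z => phi z ord0 i)) ->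
  (forall z, E z -> K (phi z)) -> K (wmean phi).
Proof.
move=> cK vK bphi Kphi.
have /compact_bounded[M [_ KM]] := cK.
have KM1 a : K a -> `|a| <= `|M| + 1.
  by move=> Ka; apply: KM => //; rewrite ltr_pwDr// ler_norm.
apply: (compact_closed _ cK); first exact: norm_hausdorff.
move=> B /nbhs_ballP[e /= e0 mB].
have [q Kq qm] := wmean_approx (fun a b t => @convex_setE _ _ _ a b t vK)
  KM1 bphi Kphi e0.
by exists q; split => //; apply: mB; rewrite -ball_normE.
Qed.

(** The averages of [f \o phi] and [phi] are approximated by a point [(s, q)] of the epigraph, where
    [f q <= s]. As the mean is interior, [convex_lower_bound] compares [f] there with [f q]. *)
Lemma jensen_wmean d (X : set 'rV[R]_d) (f : 'rV[R]_d -> R)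
    (phi : S -> 'rV[R]_d) :
  convex_body X -> convex_function (X : set (convex_lmodType 'rV[R]_d)) f ->
  (forall z, X z -> -1 <= f z <= 1) ->
  (forall i, bounded_measurable E (fun z => phi z ord0 i)) ->
  bounded_measurable E (f \o phi) ->
  (forall z, E z -> X (phi z)) -> X° (wmean phi) ->
  f (wmean phi) <= wavg mu E w (f \o phi).
Proof.
move=> [cX vX _] cf f1 bphi bf Xphi /interior_ballP[r r0 mrX].
have /compact_bounded[M [_ XM]] := cX.
have XM1 a : X a -> `|a| <= `|M| + 1.
  by move=> Ka; apply: XM => //; rewrite ltr_pwDr// ler_norm.
apply/ler_addgt0Pr => e e0.
(* The epigraph, with the height as coordinate 0, is cut at height 1 to be bounded; it still
   contains every [psi z] because [f <= 1]. *)
pose K := [set cons_row p | p in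
  [set p : R * 'rV[R]_d | [/\ X p.2, f p.2 <= p.1 & p.1 <= 1]]].
pose psi z := cons_row (f (phi z), phi z).
have cK a b (t : R) : K a -> K b -> 0 <= t -> t <= 1 ->
    K (t *: a + (1 - t) *: b).
  move=> [[a1 a2] /= [Xa fa la] <-] [[b1 b2] /= [Xb fb lb] <-] t0 t1.
  exists (t * a1 + (1 - t) * b1, t *: a2 + (1 - t) *: b2).
    split => /=; first exact: convex_setE.
      apply: (le_trans (convex_functionE cf Xa Xb t0 t1)).
      by rewrite lerD// ler_wpM2l// subr_ge0.
    by nra.
  apply/rowP => i; rewrite !mxE; case: unlift => [j|//].
  by rewrite !mxE.
have KM a : K a -> `|a| <= `|M| + 1.
  move=> [[a1 a2] /= [Xa fa la] <-].
  have := f1 _ Xa => /andP[fa1 _].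
  apply: row_norm_le => [|i]; first by rewrite addr_ge0.
  case: (unliftP ord0 i) => [j ->|->].
    by rewrite cons_rowS/= (le_trans (coord_le_norm _ _))// XM1.
  rewrite cons_row0/= (@le_trans _ _ 1) ?lerDr// ler_norml la.
  by rewrite (le_trans fa1).
have bpsi i : bounded_measurable E (fun z => psi z ord0 i).
  case: (unliftP ord0 i) => [j ->|->].
    by under eq_fun do rewrite cons_rowS; exact: bphi.
  by under eq_fun do rewrite cons_row0; exact: bf.
have Kpsi z : E z -> K (psi z).
  move=> Ez; exists (f (phi z), phi z) => //=; split => //; first exact: Xphi.
  by have /andP[] := f1 _ (Xphi _ Ez).
(* One [e'] is lost in the height and two in [convex_lower_bound]. *)
pose e' := Num.min 1 (e / 3).
have e'0 : 0 < e' by rewrite lt_min ltr01 divr_gt0.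
have e'1 : e' <= 1 by rewrite ge_min lexx.
have e'e : e' <= e / 3 by rewrite ge_min lexx orbT.
have e''0 : 0 < Num.min e' (e' * r) by rewrite lt_min e'0 mulr_gt0.
have [_ [[s q] /= [Xq fq s1] <-]] := wmean_approx cK KM bpsi Kpsi e''0.
set v := _ - _ => vlt.
have vE : v ord0 ord0 = wavg mu E w (f \o phi) - s.
  rewrite !mxE unlift_none/=; congr (_ - _).
  by apply: eq_wavg => z _; rewrite cons_row0.
have vS j : v ord0 (lift ord0 j) = (wmean phi - q) ord0 j.
  rewrite !mxE liftK/=; congr (_ - _).
  by apply: eq_wavg => z _; rewrite cons_rowS.
have v0 : `|v ord0 ord0| < e'.
  apply: le_lt_trans (coord_le_norm _ _) (lt_le_trans vlt _).
  by rewrite ge_min lexx.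
have qm : `|q - wmean phi| < e' * r.
  rewrite distrC; apply: row_norm_lt; first exact: mulr_gt0.
  move=> i; rewrite -vS.
  apply: le_lt_trans (coord_le_norm _ _) (lt_le_trans vlt _).
  by rewrite ge_min lexx orbT.
have := convex_lower_bound cf f1 r0 mrX e'0 e'1 qm.
move: v0; rewrite vE ltr_norml => /andP[h1 h2]; lra.
Qed.

End mean_in_convex.

Lemma bounded_measurable_coor {R : realType} {d : nat} (X : set 'rV[R]_d) i :
  convex_body X -> bounded_measurable X° (fun z : 'rV[R]_d => z ord0 i).
Proof.
move=> [/compact_bounded[M [_ XM]] _ _]; split.
  by apply: measurable_funTS; exact: measurable_coor.
exists (`|M| + 1) => z /interior_subset Xz.
by rewrite (le_trans (coord_le_norm _ _))// XM// ltr_pwDr// ler_norm.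
Qed.

(* Shifting the part of the mass that lies in a small ball in any direction
   keeps it in X and shifts the mean in that direction. *)
Lemma wmean_interior {R : realType} {d : nat} (X : set 'rV[R]_d)
    (w : 'rV[R]_d -> R) :
  convex_body X -> positive_weight X° w ->
  X° (wmean (lebesgue_row d) X° w id).
Proof.
move=> bX pw; have [cX vX [y Xy]] := bX.
have mE := measurable_interior_row X.
have E0 := lebesgue_interior_gt0 bX.
have Eoo := lebesgue_interior_lty bX.
have [r r0 yrX] := (interior_ballP X y).1 Xy.
have r20 : 0 < r / 2 by rewrite divr_gt0.
pose B := [set v : 'rV[R]_d | `|v - y| < r / 2].
have mB : measurable B by apply: open_measurable_row; exact: open_row_ball.
have BX : B `<=` X°.
  rewrite -open_subsetE; last exact: open_row_ball.
  by move=> z zB; apply: yrX; rewrite (lt_trans zB)// ltr_pdivrMr// ltr_pMr// ltr1n.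
pose g : 'rV[R]_d -> R := \1_B.
have bg : bounded_measurable X° g by exact: bounded_measurable_indic.
pose P := wavg (lebesgue_row d) X° w g.
have P0 : 0 < P.
  have [bw [c c0 cw]] := pw.
  apply: divr_gt0; last exact: Rintegral_weight_gt0.
  apply: (@lt_le_trans _ _ (\int[lebesgue_row d]_(z in X°) (c * g z))).
    rewrite RintegralZl//; last exact: bounded_measurable_integrable.
    rewrite mulr_gt0// /Rintegral integral_indic// setIidl// fine_gt0//.
    rewrite lebesgue_ball_gt0//= (le_lt_trans _ Eoo)//.
    by apply: le_measure; rewrite ?inE.
  apply: le_Rintegral => //.
  - by apply: bounded_measurable_integrable => //; exact: bounded_measurableZ.
  - by apply: bounded_measurable_integrable => //; exact: bounded_measurableM.
  - by move=> z Xz; rewrite ler_wpM2r ?cw.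
set m := wmean _ _ _ _.
have rP0 : 0 < r / 2 * P by rewrite (pmulr_rgt0 _ r20).
apply/interior_ballP; exists (r / 2 * P) => //.
move=> x xm.
(* Shifting a part of mass [P] by [r / 2] times [u] moves the mean from [m] exactly to [x]. *)
pose u := (r / 2 * P)^-1 *: (x - m).
have u1 : `|u| < 1.
  rewrite normrZ gtr0_norm ?invr_gt0//.
  by rewrite ltr_pdivrMl// mulr1.
pose phi (z : 'rV[R]_d) := z + (r / 2 * g z) *: u.
have bz i := bounded_measurable_coor i bX.
have bphi i : bounded_measurable X° (fun z => (r / 2 * u ord0 i) * g z).
  exact: bounded_measurableZ.
have phiE i : (fun z => phi z ord0 i) =
    (fun z => z ord0 i + (r / 2 * u ord0 i) * g z).
  by apply/funext => z; rewrite !mxE; ring.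
have -> : x = wmean (lebesgue_row d) X° w phi.
  apply/rowP => i; rewrite !mxE phiE wavgD// wavgZ// -/P.
  rewrite (_ : wavg _ _ _ _ = m ord0 i); last by rewrite mxE.
  by rewrite !mxE; field; rewrite !gt_eqF.
apply: wmean_compact => //.
  by move=> i; rewrite phiE; exact: bounded_measurableD.
move=> z Xz; rewrite /phi /g indicE; case: (boolP (z \in B)) => [|_].
  rewrite inE /B/= mulr1 => zB; apply: yrX.
  rewrite addrAC (le_lt_trans (ler_normD _ _))//.
  have : `|(r / 2) *: u| <= r / 2.
    by rewrite normrZ gtr0_norm// ler_piMr// ltW.
  by lra.
by rewrite mulr0 scale0r addr0; exact: interior_subset.
Qed.

(** * Alternating regret of continuous Hedge *)

Section hedge_regret.
Context {R : realType} {d : nat}.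
Variables (X : set 'rV[R]_d) (eta : R) (l : nat -> 'rV[R]_d -> R) (T : nat).

Definition convex_loss (f : 'rV[R]_d -> R) :=
  convex_function (X : set (convex_lmodType 'rV[R]_d)) f /\
  (forall z, X z -> -1 <= f z <= 1).

Hypotheses (bX : convex_body X) (eta0 : 0 < eta)
  (lX : forall s, (1 <= s <= T)%N -> convex_loss (l s)).

Let L (t : nat) : 'rV[R]_d -> R := hedge_weight eta [seq l s | s <- iota 1 t].
(** Indexed by the number of losses seen: [x t.-1] and [x t] are the decisions before and after loss
    [t]. *)
Let x (t : nat) : 'rV[R]_d :=
  continuous_hedge eta X [seq l s | s <- iota 1 t].
Let mu := @lebesgue_row R d.

Let mE := measurable_interior_row X.
Let E0 := lebesgue_interior_gt0 bX.
Let Eoo := lebesgue_interior_lty bX.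

Let bl s : (1 <= s <= T)%N -> bounded_measurable X° (l s).
Proof. by move=> /lX[? ?]; exact: convex_bounded_measurable. Qed.

Lemma positive_hedge_weight t : (t <= T)%N -> positive_weight X° (L t).
Proof.
move=> tT; apply: positive_weight_expR; apply: bounded_measurableZ.
under eq_fun do rewrite big_map.
apply: bounded_measurable_sum => s; rewrite mem_iota add1n ltnS => /andP[s1 st].
by apply: bl; rewrite s1 (leq_trans st).
Qed.

(** The boundary is null. All integrals move to the interior, where convex losses are measurable. *)
Let Rintegral_interior (f : 'rV[R]_d -> R) :
  \int[mu]_(z in X) f z = \int[mu]_(z in X°) f z.
Proof.
rewrite /Rintegral (@integral_setD_null _ _ _ mu X (X `\` X°))//.
- by rewrite setDD setIidr//; exact: interior_subset.
- by apply: measurableD => //; exact: measurable_convex_body.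
- exact: lebesgue_boundary0.
Qed.

Lemma continuous_hedge_wmean t : (t <= T)%N -> x t = wmean mu X° (L t) id.
Proof.
move=> tT; have pw := positive_hedge_weight tT; have [bw _] := pw.
apply/rowP => i; rewrite !mxE Rintegral_interior /hedge_density Rintegral_interior.
rewrite /wavg mulrC -RintegralZl//.
  by apply: eq_Rintegral => z _; rewrite mulrAC mulrC mulrA.
apply: bounded_measurable_integrable => //.
by apply: bounded_measurableM => //; exact: bounded_measurable_coor.
Qed.

Lemma continuous_hedge_interior t : (t <= T)%N -> X° (x t).
Proof.
move=> tT; rewrite continuous_hedge_wmean//.
by apply: wmean_interior => //; exact: positive_hedge_weight.
Qed.

Let jensen t f : (t <= T)%N -> convex_loss f -> f (x t) <= wavg mu X° (L t) f.
Proof.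
move=> tT [cf f1]; have pw := positive_hedge_weight tT.
rewrite continuous_hedge_wmean//.
apply: (jensen_wmean mE E0 Eoo pw bX cf f1).
- by move=> i; exact: bounded_measurable_coor.
- exact: convex_bounded_measurable.
- by move=> z; exact: interior_subset.
- exact: wmean_interior.
Qed.

Let Z t : R := \int[mu]_(z in X°) L t z.

Let Z0 t : (t <= T)%N -> 0 < Z t.
Proof.
by move=> tT; apply: Rintegral_weight_gt0 => //; exact: positive_hedge_weight.
Qed.

Let LS t z : L t.+1 z = L t z * expR (- eta * l t.+1 z).
Proof.
rewrite /L /hedge_weight -expRD -mulrDr; congr (expR (_ * _)).
by rewrite -[t.+1 in LHS]addn1 iotaD map_cat big_cat/= big_seq1 add1n.
Qed.

(** Jensen bounds the two losses by the mean losses [p] and [q] before and after the update. The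
    trapezoid rule for [- eta * l t.+1] bounds [p + q]; multiplication by [2 / eta] turns its error
    [32 * eta ^+ 3] into [64 * eta ^+ 2]. *)
Lemma hedge_step t : (t < T)%N ->
  l t.+1 (x t) + l t.+1 (x t.+1) <=
  2 / eta * (ln (Z t) - ln (Z t.+1)) + 64 * eta ^+ 2.
Proof.
move=> tT; have lt := @lX t.+1 tT.
have pw := positive_hedge_weight (ltnW tT).
have bf : bounded_measurable X° (l t.+1) by exact: bl.
pose Y z := - eta * l t.+1 z.
have bY : bounded_measurable X° Y by exact: bounded_measurableZ.
have Ye z : X° z -> `|Y z| <= eta.
  move=> /interior_subset Xz; rewrite normrM normrN (gtr0_norm eta0).
  by rewrite ler_piMr ?(ltW eta0)// ler_norml; exact: lt.2.
pose p := wavg mu X° (L t) (l t.+1); pose q := wavg mu X° (L t.+1) (l t.+1).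
have hp : l t.+1 (x t) <= p := jensen (ltnW tT) lt.
have hq : l t.+1 (x t.+1) <= q := jensen tT lt.
have rearrange (a b : R) :
    a - b <= (- eta * p + - eta * q) / 2 + 32 * eta ^+ 3 ->
    p + q <= 2 / eta * (b - a) + 64 * eta ^+ 2.
  move: p q {hp hq} => p q h; rewrite -(ler_pM2l eta0).
  rewrite (_ : eta * (2 / eta * (b - a) + _) = 2 * (b - a) + 64 * eta ^+ 3).
    by lra.
  by field; rewrite gt_eqF.
apply: le_trans (lerD hp hq) (rearrange _ _ _).
rewrite -ln_div ?posrE; [|exact: Z0|exact/Z0/ltnW].
have -> : Z t.+1 / Z t = wavg mu X° (L t) (fun z => expR (Y z)).
  by congr (_ / _); apply: eq_Rintegral => z _; rewrite LS.
rewrite -[- eta * p](wavgZ mE Eoo pw (- eta) bf).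
rewrite -[- eta * q](wavgZ mE Eoo (positive_hedge_weight tT) (- eta) bf).
rewrite (_ : L t.+1 = fun z => L t z * expR (Y z)); last exact/funext/LS.
exact: ln_wavg_expR_trapezoid.
Qed.

Lemma hedge_telescope n : (n <= T)%N ->
  \sum_(1 <= t < n.+1) (l t (x t.-1) + l t (x t)) <=
  2 / eta * (ln (Z 0) - ln (Z n)) + 64 * eta ^+ 2 * n%:R.
Proof.
elim: n => [|n IHn] nT; first by rewrite big_geq// subrr !mulr0 addr0.
rewrite big_nat_recr//=.
apply: le_trans (lerD (IHn (ltnW nT)) (hedge_step nT)) _.
have E (a b c q : R) : 2 / eta * (a - b) + 64 * eta ^+ 2 * q +
    (2 / eta * (b - c) + 64 * eta ^+ 2) =
    2 / eta * (a - c) + 64 * eta ^+ 2 * (q + 1) by ring.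
by rewrite E natr1.
Qed.

(* The copy of X contracted by 1 / T towards u has volume T ^- d vol(X), and on
   it the total loss exceeds the one of u by at most 2. *)
Lemma hedge_partition_ge (u : 'rV[R]_d) : (0 < T)%N -> X u ->
  ln (Z 0) - d%:R * ln T%:R - eta * (\sum_(1 <= t < T.+1) l t u + 2) <= ln (Z T).
Proof.
move=> T0 Xu; have [_ vX _] := bX.
have TR : 0 < T%:R :> R by rewrite ltr0n.
have T1 : 1 <= T%:R :> R by rewrite ler1n.
(* The contracted copy of [X°], written as a preimage under the inverse expansion to match
   [lebesgue_row_affine]. *)
pose S : set 'rV[R]_d := (fun z => (1 - T%:R) *: u + T%:R *: z) @^-1` X°.
have mS : measurable S.
  by rewrite -[X in measurable X]setTI; exact: measurable_affine_row.
have dT0 : 0 <= T%:R^-1 :> R by rewrite invr_ge0 ltW.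
have dT1 : T%:R^-1 <= 1 :> R by rewrite invf_le1.
have SE z : z = T%:R^-1 *: ((1 - T%:R) *: u + T%:R *: z) + (1 - T%:R^-1) *: u.
  by apply/rowP => i; rewrite !mxE; field; rewrite gt_eqF.
have SX : S `<=` X°.
  move=> z Sz; rewrite (SE z); apply: convex_interior => //.
  by rewrite invr_gt0.
pose V := fine (mu X°).
have Xfin : mu X° \is a fin_num by rewrite ge0_fin_numE.
have Soo : (mu S < +oo)%E.
  by apply: le_lt_trans Eoo; apply: le_measure; rewrite ?inE.
have VS : V = T%:R ^+ d * fine (mu S).
  have Sfin : mu S \is a fin_num by rewrite ge0_fin_numE.
  rewrite /V /mu (lebesgue_row_affine ((1 - T%:R) *: u) TR mE).
  by rewrite (fineM _ Sfin).
have V0 : 0 < V by rewrite fine_gt0// E0 Eoo.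
have Z0E : Z 0 = V.
  rewrite /Z (@eq_Rintegral _ _ _ mu X° (fun=> 1)).
    by rewrite Rintegral_cst// mul1r.
  by move=> z _; rewrite /L /hedge_weight big_nil mulr0 expR0.
(* A lower bound for the final weight on [S]: there each loss exceeds that of [u] by at most
   [2 / T], which sums to 2 over the rounds. *)
pose m := expR (- eta * (\sum_(1 <= t < T.+1) l t u + 2)).
have ZT : m * fine (mu S) <= Z T.
  have -> : m * fine (mu S) = \int[mu]_(z in X°) (m * \1_S z).
    rewrite RintegralZl//; last first.
      apply: bounded_measurable_integrable => //.
      exact: bounded_measurable_indic.
    by rewrite /Rintegral integral_indic// setIidl.
  apply: le_Rintegral => //.
  - apply: bounded_measurable_integrable => //; apply: bounded_measurableZ.
    exact: bounded_measurable_indic.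
  - apply: bounded_measurable_integrable => //.
    by have [] := positive_hedge_weight (leqnn T).
  - move=> z Xz; rewrite indicE; case: (boolP (z \in S)) => [|_].
      rewrite inE mulr1 => Sz; rewrite /m /L /hedge_weight ler_expR.
      rewrite ler_nM2l ?oppr_lt0// big_map.
      have -> : 2 = \sum_(1 <= t < T.+1) (2 * T%:R^-1) :> R.
        rewrite sumr_const_nat subSS subn0 -[RHS]mulr_natr divfK//.
        by rewrite gt_eqF.
      rewrite -big_split/= /index_iota subSS subn0 big_seq [leRHS]big_seq.
      apply: ler_sum => s; rewrite mem_iota add1n ltnS => sT.
      have [cl l1] := lX sT.
      rewrite {1}(SE z).
      have Xz' := interior_subset Sz.
      apply: le_trans (convex_functionE cl Xz' Xu dT0 dT1) _.
      have /andP[_ h1] := l1 _ Xz'; have /andP[h2 _] := l1 _ Xu.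
      by move: (T%:R^-1) dT0 h1 h2 => q q0; nra.
    by rewrite mulr0 expR_ge0.
have S0 : 0 < fine (mu S).
  by move: V0; rewrite VS pmulr_rgt0// exprn_gt0.
have : ln (m * fine (mu S)) <= ln (Z T).
  by rewrite ler_ln ?posrE ?Z0// mulr_gt0// expR_gt0.
apply: le_trans; rewrite Z0E VS !lnM ?posrE ?exprn_gt0// ?expR_gt0//.
rewrite lnXn// expRK mulr_natl.
by move: (ln _) (ln _ *+ d) (\sum_(_ <= _ < _) _) => a b c; lra.
Qed.

(** Inserting the lower bound on [Z T] into the telescoped sum; the 4 is [2 / eta] times the
    contraction loss [2 * eta]. *)
Lemma hedge_alternating_regret (u : 'rV[R]_d) : (0 < T)%N -> X u ->
  \sum_(1 <= t < T.+1) (l t (x t.-1) + l t (x t)) <=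
  2 * \sum_(1 <= t < T.+1) l t u + 4 +
  2 * (d%:R * ln T%:R) / eta + 64 * eta ^+ 2 * T%:R.
Proof.
move=> T0 Xu; apply: le_trans (hedge_telescope (leqnn T)) _.
have := hedge_partition_ge T0 Xu.
move: (ln (Z 0)) (ln (Z T)) (d%:R * _) (\sum_(_ <= _ < _) _) => a b c s h.
rewrite lerD2r.
have : 2 / eta * (a - b) <= 2 / eta * (c + eta * (s + 2)).
  by rewrite ler_pM2l ?divr_gt0//; lra.
move=> /le_trans; apply; rewrite le_eqVlt; apply/orP; left; apply/eqP.
by field; rewrite gt_eqF.
Qed.

End hedge_regret.

(** * Expectation under a uniform distribution over a list *)

Section uniform_over_integral.
Context {R : realType} {disp} {S : measurableType disp}.
Variable s : seq S.
Hypothesis s0 : (0 < size s)%N.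
Hypothesis mS1 : forall a : S, measurable [set a].
Local Open Scope ereal_scope.

Let n : R := (size s)%:R.

(** The total mass is the length of the list, which is nonzero and finite, so the default branch of
    [mnormalize] does not occur. *)
Lemma uniform_overE (U : set S) : uniform_over s U =
  (\sum_(k < size s) \d_(nth point s k) U) * (n^-1)%:E :> \bar R.
Proof.
have evid : \sum_(k < size s) \d_(nth point s k) [set: S] = n%:E :> \bar R.
  rewrite (eq_bigr (fun=> 1%:E)) => [|k _]; last by rewrite diracT.
  by rewrite sumEFin sumr_const card_ord.
have normE (e : \bar R) (f g : set S -> \bar R) : e = n%:E ->
    (if (e == 0) || (e == +oo) then f else fun V => g V * (fine e)^-1%:E) U =
    g U * (n^-1)%:E.
  by move=> ->; rewrite ifF// orbF eqe pnatr_eq0 gtn_eqF.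
exact: normE evid.
Qed.

Let measurable_finite (A : set S) : finite_set A -> measurable A.
Proof.
move=> fA; rewrite (_ : A = \bigcup_(a in A) [set a]).
  by apply: fin_bigcup_measurable => // a _; exact: mS1.
by apply/seteqP; split=> [a Aa|a [b Ab ->]//]; exists a.
Qed.

Let A : set S := [set` s].

Let fA : finite_set A. Proof. exact: finite_seq. Qed.

Let mA : measurable A. Proof. exact: measurable_finite. Qed.

Let dA k : (k < size s)%N -> \d_(nth point s k) A = 1 :> \bar R.
Proof. by move=> ks; rewrite diracE mem_set// /A/= mem_nth. Qed.

Let ge0_integral_uniform_over (f : S -> R) : (forall z, (0 <= f z)%R) ->
  \int[uniform_over s]_(z in A) (f z)%:E = (n^-1 * \sum_(z <- s) f z)%:E.
Proof.
move=> f0.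
have mf : measurable_fun A (fun z => (f z)%:E).
  move=> _ B _; apply: measurable_finite; apply: sub_finite_set fA.
  exact: subIsetl.
have n0 : (0 <= n^-1)%R by rewrite invr_ge0.
rewrite (_ : \int[_]_(z in A) _ = \int[mscale (NngNum n0)
    (msum (fun k => \d_(nth point s k)) (size s))]_(z in A) (f z)%:E); last first.
  apply: eq_measure_integral => B mB _.
  by apply: (etrans (uniform_overE B)); rewrite muleC.
have fE z : A z -> 0 <= (f z)%:E by rewrite lee_fin.
rewrite ge0_integral_mscale//= ge0_integral_measure_sum//.
rewrite (eq_bigr (fun k : 'I_(size s) => (f (nth point s k))%:E)) => [|k _].
  by rewrite sumEFin -EFinM (big_nth point) big_mkord.
by rewrite integral_dirac// dA// mul1e.
Qed.

(** Outside the list the mass is 0, and on a finite set with measurable singletons every function is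
    measurable; hence [f] is arbitrary. *)
Lemma expectation_uniform_over (f : S -> R) :
  'E_(uniform_over s)[f] = (n^-1 * \sum_(z <- s) f z)%:E.
Proof.
rewrite unlock (@integral_setD_null _ _ _ _ _ (~` A)); last 2 first.
- exact: measurableC.
- apply: (etrans (uniform_overE _)); rewrite big1 ?mul0e// => k _.
  by rewrite diracE memNset// => nA; apply: nA; rewrite /A/= mem_nth.
rewrite setTD setCK integralE.
rewrite (@eq_integral _ _ _ _ A (fun z => (f^\+%R z)%:E)); last first.
  by move=> z _; rewrite -[RHS]/((EFin \o f^\+%R) z) -funerpos.
rewrite [X in _ - X](@eq_integral _ _ _ _ A (fun z => (f^\-%R z)%:E)); last first.
  by move=> z _; rewrite -[RHS]/((EFin \o f^\-%R) z) -funerneg.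
rewrite !ge0_integral_uniform_over => [|z|z]; [|exact: funrneg_ge0|exact: funrpos_ge0].
rewrite -EFinB -mulrBr -sumrB; congr (_ * _)%:E; apply: eq_bigr => z _.
by rewrite -[in RHS](funrposBneg f).
Qed.

End uniform_over_integral.

(** * The rate *)

Section rate.
Context {R : realType}.

(** In terms of cube roots the fractional exponents become integers, within reach of [field]. *)
Let cbrt (v : R) : R := v `^ (1 / 3).

Let cbrt2 v : v `^ (2 / 3) = cbrt v ^+ 2.
Proof.
rewrite /cbrt -powR_mulrn ?powR_ge0// -powRrM; congr (_ `^ _).
by field.
Qed.

Let cbrt3 v : 0 <= v -> cbrt v ^+ 3 = v.
Proof.
move=> v0; rewrite /cbrt -powR_mulrn ?powR_ge0// -powRrM.
by rewrite (_ : 1 / 3 * 3%:R = 1) ?powRr1//; field.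
Qed.

Lemma ln2_ge : 1 / 2 <= ln 2 :> R.
Proof.
rewrite -[leLHS]expRK ler_ln ?posrE ?expR_gt0//.
rewrite -[1 / 2]opprK expRN -[leRHS]invrK lef_pV2 ?posrE ?expR_gt0//.
by have := expR_ge1Dx (- (1 / 2) : R); lra.
Qed.

(** With [a], [b], [c] the cube roots of [d], [T], [ln T], the numerator is
    [8 + 66 * (a ^+ 2 * b) * c ^+ 2]. From [ln T >= 1 / 2] follow [1 <= 2 * c ^+ 3] and
    [c ^+ 2 <= 2 * c ^+ 3], whence [16 + 132 = 148]. *)
Lemma hedge_rate (d T : nat) : (0 < d)%N -> (2 <= T)%N ->
  let eta := (d%:R * ln T%:R) `^ (1 / 3) * T%:R `^ (- (1 / 3)) : R in
  0 < eta /\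
  (4 + 2 * (d%:R * ln T%:R) / eta + 64 * eta ^+ 2 * T%:R + 4) / T%:R <=
  148 * ln T%:R ^+ 1 * (d%:R `^ (2 / 3) * T%:R `^ (- (2 / 3))).
Proof.
move=> d0 T2 eta.
have T0 : 0 < T%:R :> R by rewrite ltr0n (leq_trans _ T2).
have lnT : 1 / 2 <= ln T%:R :> R.
  by rewrite (le_trans ln2_ge)// ler_ln ?posrE// ler_nat.
have lnT0 : 0 <= ln T%:R :> R by lra.
have dR : 1 <= d%:R :> R by rewrite ler1n.
have dR0 : 0 <= d%:R :> R by exact: ler0n.
pose a := cbrt d%:R; pose b := cbrt T%:R; pose c := cbrt (ln T%:R).
have a3 : a ^+ 3 = d%:R by exact: cbrt3.
have b3 : b ^+ 3 = T%:R by apply: cbrt3; exact: ltW.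
have c3 : c ^+ 3 = ln T%:R by exact: cbrt3.
have b0 : 0 < b by exact: powR_gt0.
have a1 : 1 <= a.
  by rewrite -(@ler_pXn2r _ 3) ?nnegrE ?powR_ge0// expr1n a3.
have b1 : 1 <= b.
  rewrite -(@ler_pXn2r _ 3) ?nnegrE ?powR_ge0// expr1n b3 ler1n.
  exact: leq_trans T2.
have c12 : 1 / 2 <= c.
  rewrite -(@ler_pXn2r _ 3) ?nnegrE ?powR_ge0// c3.
  by rewrite !exprS expr0; lra.
have a0 : 0 < a by lra.
have c0 : 0 < c by lra.
have etaE : eta = a * c / b.
  by rewrite /eta powRM// powRN.
split; first by rewrite etaE divr_gt0// mulr_gt0.
rewrite ler_pdivrMr// powRN !cbrt2 -/a -/b etaE expr1 -a3 -c3 -b3.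
have -> : 4 + 2 * (a ^+ 3 * c ^+ 3) / (a * c / b) +
    64 * (a * c / b) ^+ 2 * b ^+ 3 + 4 = 8 + 66 * (a ^+ 2 * b) * c ^+ 2.
  by field; rewrite !gt_eqF.
have -> : 148 * c ^+ 3 * (a ^+ 2 * (b ^+ 2)^-1) * b ^+ 3 =
    148 * (a ^+ 2 * b) * c ^+ 3.
  by field; rewrite gt_eqF.
have q1 : 1 <= a ^+ 2 * b by apply: mulr_ege1 => //; apply: exprn_ege1.
have c23 : c ^+ 2 <= 2 * c ^+ 3.
  by rewrite [c ^+ 3]exprS mulrA ler_peMl ?sqr_ge0//; lra.
have c31 : 1 <= 2 * c ^+ 3 by rewrite c3; lra.
have c30 : 0 <= c ^+ 3 by rewrite c3.
move: (a ^+ 2 * b) (c ^+ 2) (c ^+ 3) q1 c23 c31 c30 => q m n q1 mn n1 n0.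
have : q * m <= q * (2 * n) by rewrite ler_wpM2l//; lra.
have : 1 * n <= q * n by rewrite ler_wpM2r.
by lra.
Qed.

End rate.

(** * Finite averages in convex sets *)

Section average.
Context {R : realType} {d : nat}.
Variable X : set 'rV[R]_d.
Hypothesis vX : convex_set (X : set (convex_lmodType 'rV[R]_d)).

Let avg_step (p : nat -> 'rV[R]_d) n :
  n.+2%:R^-1 *: \sum_(1 <= t < n.+3) p t =
  (1 - n.+2%:R^-1) *: (n.+1%:R^-1 *: \sum_(1 <= t < n.+2) p t) +
  (1 - (1 - n.+2%:R^-1)) *: p n.+2.
Proof.
rewrite big_nat_recr//= scalerDr subKr; congr (_ + _).
rewrite scalerA; congr (_ *: _).
rewrite -[n.+2%:R]natr1 mulrBl; field.
by rewrite nat1r natr1 !pnatr_eq0.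
Qed.

Let inv01 n : 0 <= 1 - n.+2%:R^-1 :> R /\ 1 - n.+2%:R^-1 <= 1 :> R.
Proof.
split; last by rewrite gerBl invr_ge0.
by rewrite subr_ge0 invf_le1// ler1n.
Qed.

Lemma convex_average n (p : nat -> 'rV[R]_d) :
  (forall t, (1 <= t <= n.+1)%N -> X (p t)) ->
  X (n.+1%:R^-1 *: \sum_(1 <= t < n.+2) p t).
Proof.
elim: n => [|n IHn] Xp.
  by rewrite big_nat1 invr1 scale1r; exact: Xp.
rewrite avg_step; have [? ?] := inv01 n; apply: convex_setE => //.
  by apply: IHn => t /andP[t1 tn]; apply: Xp; rewrite t1 ltnW.
by apply: Xp; rewrite leqnn.
Qed.

Lemma convex_function_average n (p : nat -> 'rV[R]_d) (f : 'rV[R]_d -> R) :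
  convex_function (X : set (convex_lmodType 'rV[R]_d)) f ->
  (forall t, (1 <= t <= n.+1)%N -> X (p t)) ->
  f (n.+1%:R^-1 *: \sum_(1 <= t < n.+2) p t) <=
  n.+1%:R^-1 * \sum_(1 <= t < n.+2) f (p t).
Proof.
move=> cf; elim: n => [|n IHn] Xp.
  by rewrite !big_nat1 !invr1 scale1r mul1r.
have Xp' t : (1 <= t <= n.+1)%N -> X (p t).
  by move=> /andP[t1 tn]; apply: Xp; rewrite t1 ltnW.
rewrite avg_step; have [h0 h1] := inv01 n.
have Xn : X (p n.+2) by apply: Xp; rewrite leqnn.
apply: le_trans (convex_functionE cf (convex_average Xp') Xn h0 h1) _.
rewrite [in leRHS]big_nat_recr//= mulrDr subKr lerD2r.
apply: le_trans (ler_wpM2l h0 (IHn Xp')) _.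
rewrite mulrA le_eqVlt; apply/orP; left; apply/eqP; congr (_ * _).
rewrite -[n.+2%:R]natr1; field.
by rewrite nat1r natr1 !pnatr_eq0.
Qed.

End average.

(** * Equilibria *)

Section alternating_hedge.
Context {R : realType} {d : nat}.
Variables (X Y : set 'rV[R]_d) (u1 u2 : 'rV[R]_d -> 'rV[R]_d -> R) (eta : R).
Variables (T : nat) (x y : nat -> 'rV[R]_d).
Hypotheses (bX : convex_body X) (bY : convex_body Y) (eta0 : 0 < eta)
  (T0 : (0 < T)%N).
Hypotheses (u1X : forall b, Y b -> convex_loss X (u1^~ b))
  (u2Y : forall a, X a -> convex_loss Y (u2 a)).
Hypothesis play : alternating_play (continuous_hedge eta X)
  (continuous_hedge eta Y) u1 u2 T x y.

(** Induction along the order of play: a Hedge output is interior once its past losses are convex,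
    and these are convex once the opponent's earlier decisions are in their domain. The x-player is
    one index ahead. *)
Lemma alternating_hedge_mem n : (n <= T)%N ->
  (forall t, (1 <= t <= n.+1)%N -> X (x t)) /\
  (forall t, (1 <= t <= n)%N -> Y (y t)).
Proof.
have [hx hy] := play.
have hl0 Z (l : nat -> 'rV[R]_d -> R) s : (1 <= s <= 0)%N -> convex_loss Z (l s).
  by case: s.
elim: n => [|n IHn] nT.
  split=> t; last by case: t.
  case: t => [//|[|//]] _; rewrite hx//.
  apply: interior_subset.
  exact: (@continuous_hedge_interior _ _ X eta (fun s => u1^~ (y s)) 0
    bX (hl0 X _) 0 isT).
have [IHx IHy] := IHn (ltnW nT).
have {}IHy t : (1 <= t <= n.+1)%N -> Y (y t).
  move=> /andP[t1]; rewrite leq_eqVlt => /predU1P[->|tn]; last first.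
    by apply: IHy; rewrite t1.
  rewrite hy ?nT//; apply: interior_subset.
  apply: (@continuous_hedge_interior _ _ Y eta (fun s => u2 (x s)) n.+1 bY) => //.
  by move=> s sn; exact/u2Y/IHx.
split=> // t /andP[t1]; rewrite leq_eqVlt => /predU1P[->|tn]; last first.
  by apply: IHx; rewrite t1.
rewrite hx ?ltnS ?nT//; apply: interior_subset.
apply: (@continuous_hedge_interior _ _ X eta (fun s => u1^~ (y s)) n.+1 bX) => //.
by move=> s sn; exact/u1X/IHy.
Qed.

Let xX t : (1 <= t <= T.+1)%N -> X (x t).
Proof. by have [h _] := alternating_hedge_mem (leqnn T); exact: h. Qed.

Let yY t : (1 <= t <= T)%N -> Y (y t).
Proof. by have [_ h] := alternating_hedge_mem (leqnn T); exact: h. Qed.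

Let B : R := 4 + 2 * (d%:R * ln T%:R) / eta + 64 * eta ^+ 2 * T%:R.

(** The centroid of [Y], serving as the decision of the y-player before the first loss. *)
Let y0 : 'rV[R]_d := continuous_hedge eta Y [::].

Let Yy0 : Y y0.
Proof.
apply: interior_subset.
(* Over zero rounds the losses are arbitrary; [u2 0] is a placeholder. *)
have h (s : nat) : (1 <= s <= 0)%N -> convex_loss Y (u2 0) by case: s.
exact: (@continuous_hedge_interior _ _ Y eta (fun=> u2 0) 0 bY h 0 isT).
Qed.

(** [x t] has seen [t - 1] losses and [x t.+1] has seen [t]: they are the decisions before and after
    loss [t]. *)
Lemma regret_x (a : 'rV[R]_d) : X a ->
  \sum_(1 <= t < T.+1) (u1 (x t) (y t) + u1 (x t.+1) (y t)) <=
  2 * (\sum_(1 <= t < T.+1) u1 a (y t)) + B.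
Proof.
move=> Xa; have [hx _] := play.
have lX s : (1 <= s <= T)%N -> convex_loss X (u1^~ (y s)) by move=> /yY/u1X.
have := hedge_alternating_regret bX eta0 lX T0 Xa.
rewrite /B !addrA.
apply: le_trans; rewrite le_eqVlt; apply/orP; left; apply/eqP.
apply: eq_big_nat => t /andP[t1 tT]; rewrite !hx//.
by rewrite t1 ltnW.
Qed.

Let y' t := if t is 0%N then y0 else y t.

(** [y t] has already seen the loss of round [t], so the decision before it is that of round
    [t - 1]. *)
Lemma regret_y (b : 'rV[R]_d) : Y b ->
  \sum_(1 <= t < T.+1) (u2 (x t) (y' t.-1) + u2 (x t) (y t)) <=
  2 * (\sum_(1 <= t < T.+1) u2 (x t) b) + B.
Proof.
move=> Yb; have [_ hy] := play.
have lY s : (1 <= s <= T)%N -> convex_loss Y (u2 (x s)).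
  by move=> /andP[s1 sT]; apply/u2Y/xX; rewrite s1 leqW.
have := hedge_alternating_regret bY eta0 lY T0 Yb.
rewrite /B !addrA.
apply: le_trans; rewrite le_eqVlt; apply/orP; left; apply/eqP.
apply: eq_big_nat => -[//|t] /andP[_ tT]; rewrite /= (hy t.+1)//; congr (_ + _).
case: t tT => [//|t] tT /=; rewrite hy//.
by rewrite /= ltnW.
Qed.

Let u1B a b : X a -> Y b -> -1 <= u1 a b <= 1.
Proof. by move=> Xa /u1X[_]; exact. Qed.

Let u2B a b : X a -> Y b -> -1 <= u2 a b <= 1.
Proof. by move=> /u2Y[_ h] /h. Qed.

Let x1X : X (x 1). Proof. exact: xX. Qed.
Let xTX : X (x T.+1). Proof. by apply: xX; rewrite leqnn. Qed.
Let yTY : Y (y T). Proof. by apply: yY; rewrite T0 leqnn. Qed.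

Let sum_shift (F : nat -> R) :
  \sum_(1 <= t < T.+1) F t.+1 = \sum_(1 <= t < T.+1) F t - F 1%N + F T.+1.
Proof.
elim: T => [|n IHn]; first by rewrite !big_geq// sub0r addNr.
by rewrite big_nat_recr//= IHn [in RHS]big_nat_recr//=; ring.
Qed.

Let y'E t : (0 < t)%N -> y' t = y t. Proof. by case: t. Qed.

(** Shifting the index turns [u2 (x t.+1) (y t)] into [u2 (x t) (y' t.-1)] up to two boundary terms,
    and likewise for the comparator. Four values in [[-1, 1]] cost at most 4. *)
Lemma shifted_regret_y (b : 'rV[R]_d) : Y b ->
  \sum_(1 <= t < T.+1) (u2 (x t) (y t) + u2 (x t.+1) (y t)) <=
  \sum_(1 <= t < T.+1) (u2 (x t) b + u2 (x t.+1) b) + (B + 4).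
Proof.
move=> Yb; have := regret_y Yb.
have -> : \sum_(1 <= t < T.+1) (u2 (x t) (y t) + u2 (x t.+1) (y t)) =
    \sum_(1 <= t < T.+1) (u2 (x t) (y' t.-1) + u2 (x t) (y t)) -
    u2 (x 1) y0 + u2 (x T.+1) (y T).
  rewrite !big_split/= -(y'E T0).
  have -> : \sum_(1 <= t < T.+1) u2 (x t.+1) (y t) =
      \sum_(1 <= t < T.+1) u2 (x t.+1) (y' t).
    by apply: eq_big_nat => t /andP[t1 _]; rewrite y'E.
  by rewrite (sum_shift (fun t => u2 (x t) (y' t.-1)))/=; ring.
rewrite [X in _ -> _ <= X + _]big_split/= (sum_shift (fun t => u2 (x t) b)).
have /andP[] := u2B x1X Yy0; have /andP[] := u2B xTX yTY.
have /andP[] := u2B x1X Yb; have /andP[] := u2B xTX Yb.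
move: (u2 _ _) (u2 _ _) (u2 _ _) (u2 _ _) (\sum_(_ <= _ < _) _) (\sum_(_ <= _ < _) _) B.
by move=> a1 a2 a3 a4 s1 s2 q; lra.
Qed.

(** In the sum of the two regrets the payoffs of the play cancel up to two boundary terms, together
    at most 2. Halving [2 * B + 2] gives the bound. *)
Lemma duality_gap (a b : 'rV[R]_d) :
  (forall a b, X a -> Y b -> u2 a b = - u1 a b) -> X a -> Y b ->
  \sum_(1 <= t < T.+1) u1 (x t) b - \sum_(1 <= t < T.+1) u1 a (y t) <= B + 1.
Proof.
move=> zs Xa Yb; have := regret_x Xa; have := regret_y Yb.
have xT t : (1 <= t < T.+1)%N -> X (x t).
  by move=> /andP[t1 tT]; apply: xX; rewrite t1 ltnW.
have yT t : (1 <= t < T.+1)%N -> Y (y t) by exact: yY.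
have -> : \sum_(1 <= t < T.+1) (u2 (x t) (y' t.-1) + u2 (x t) (y t)) =
    - \sum_(1 <= t < T.+1) (u1 (x t) (y' t.-1) + u1 (x t) (y t)).
  rewrite -sumrN; apply: eq_big_nat => t tT; rewrite !zs ?opprD//.
  - exact: xT.
  - exact: yT.
  - exact: xT.
  - case: t tT => [//|[//|t]] /andP[_ tT]; apply: yY => /=.
    by rewrite ltnW.
have -> : \sum_(1 <= t < T.+1) u2 (x t) b = - \sum_(1 <= t < T.+1) u1 (x t) b.
  by rewrite -sumrN; apply: eq_big_nat => t tT; rewrite zs//; exact: xT.
have -> : \sum_(1 <= t < T.+1) (u1 (x t) (y t) + u1 (x t.+1) (y t)) =
    \sum_(1 <= t < T.+1) (u1 (x t) (y' t.-1) + u1 (x t) (y t)) -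
    u1 (x 1) y0 + u1 (x T.+1) (y T).
  rewrite !big_split/= -(y'E T0).
  have -> : \sum_(1 <= t < T.+1) u1 (x t.+1) (y t) =
      \sum_(1 <= t < T.+1) u1 (x t.+1) (y' t).
    by apply: eq_big_nat => t /andP[t1 _]; rewrite y'E.
  by rewrite (sum_shift (fun t => u1 (x t) (y' t.-1)))/=; ring.
have /andP[] := u1B x1X Yy0; have /andP[] := u1B xTX yTY.
move: (u1 (x 1) y0) (u1 (x T.+1) (y T)) B.
move: (\sum_(_ <= _ < _) u1 _ b) (\sum_(_ <= _ < _) u1 a _) (\sum_(_ <= _ < _) _).
by move=> s1 s2 s3 a1 a2 q; lra.
Qed.

Lemma alternating_hedge_cce (eps : R) : (B + 4) / T%:R <= eps ->
  coarse_correlated_equilibrium X Y u1 u2 eps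
    (uniform_over ([seq (x t, y t) | t <- iota 1 T] ++
                   [seq (x t.+1, y t) | t <- iota 1 T])).
Proof.
move=> eps_ge; set s := _ ++ _.
have sizes : size s = (T + T)%N by rewrite size_cat !size_map size_iota.
have s0 : (0 < size s)%N by rewrite sizes addn_gt0 T0.
have TR : 0 < T%:R :> R by rewrite ltr0n.
have m1 (a : 'rV[R]_d * 'rV[R]_d) : measurable [set a].
  case: a => a b; rewrite (_ : [set _] = [set a] `*` [set b]).
    apply: measurableX; apply: closed_measurable_row;
    exact/accessible_closed_set1/hausdorff_accessible/norm_hausdorff.
  by apply/seteqP; split=> [_ ->//|[? ?] [/= -> ->]].
have sumE (f : 'rV[R]_d * 'rV[R]_d -> R) : \sum_(z <- s) f z =
    \sum_(1 <= t < T.+1) (f (x t, y t) + f (x t.+1, y t)).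
  by rewrite big_cat/= !big_map big_split/= /index_iota subSS subn0.
(* The average over [2T] pairs leaves an error [(B + 4) / (2T)]; for [B >= 0] it is below
   [(B + 4) / T]. *)
have B0 : 0 <= B.
  have lnT : 0 <= ln T%:R :> R by rewrite ln_ge0// ler1n.
  by rewrite !addr_ge0// !mulr_ge0// ?invr_ge0 ?(ltW eta0) ?exprn_ge0// ltW.
have B4 : B + 4 <= T%:R * eps by rewrite mulrC -ler_pdivrMr.
have le_exp (f g : 'rV[R]_d * 'rV[R]_d -> R) :
    \sum_(z <- s) f z <= \sum_(z <- s) g z + (B + 4) ->
    ('E_(uniform_over s)[f] <= 'E_(uniform_over s)[g] + eps%:E)%E.
  move=> fg; rewrite !expectation_uniform_over// -EFinD lee_fin sizes natrD.
  have TT : 0 < T%:R + T%:R :> R by rewrite addr_gt0.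
  rewrite -(ler_pM2l TT) mulrDr !mulVKf ?gt_eqF//.
  apply: le_trans fg _; rewrite lerD2l mulrDl.
  by have := B4; have := B0; move: (T%:R * eps) => q; move: (B) => b; lra.
have sXY z : z \in s -> (X `*` Y) z.
  rewrite mem_cat => /orP[] /mapP[t]; rewrite mem_iota add1n => /andP[t1 tT] ->;
  split=> /=; (try by apply: yY; rewrite t1); apply: xX => //.
  by rewrite t1 ltnW.
split.
- apply: (etrans (uniform_overE s0 _)).
  rewrite (eq_bigr (fun=> 1%:E)) => [|k _]; last first.
    by rewrite diracE mem_set//; apply: sXY; rewrite mem_nth.
  rewrite sumEFin sumr_const card_ord -EFinM mulfV//.
  by rewrite pnatr_eq0 gtn_eqF.
- move=> a Xa; apply: le_exp; rewrite !sumE/=.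
  apply: (le_trans (regret_x Xa)); rewrite big_split/=.
  by move: (\sum_(1 <= t < T.+1) u1 a (y t)) (B) => q b; lra.
- by move=> b Yb; apply: le_exp; rewrite !sumE/=; exact: shifted_regret_y.
Qed.

Lemma alternating_hedge_nash (eps : R) : (B + 4) / T%:R <= eps ->
  (forall a b, X a -> Y b -> u2 a b = - u1 a b) ->
  nash_equilibrium X Y u1 u2 eps
    (T%:R^-1 *: \sum_(1 <= t < T.+1) x t)
    (T%:R^-1 *: \sum_(1 <= t < T.+1) y t).
Proof.
move=> eps_ge zs.
have TR : 0 < T%:R :> R by rewrite ltr0n.
have [n Tn] : exists n, T = n.+1 by exists T.-1; rewrite prednK.
have xX' t : (1 <= t <= n.+1)%N -> X (x t).
  by rewrite -Tn => /andP[t1 tT]; apply: xX; rewrite t1 leqW.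
have yY' t : (1 <= t <= n.+1)%N -> Y (y t) by rewrite -Tn; exact: yY.
have [_ vX _] := bX; have [_ vY _] := bY.
set xbar := _ *: _; set ybar := _ *: _.
have Xbar : X xbar by rewrite /xbar Tn; exact: convex_average.
have Ybar : Y ybar by rewrite /ybar Tn; exact: convex_average.
(* Convexity of [u1] in its first argument and of [u2 = - u1] in its second compares both values
   with averages along the play, to which [duality_gap] applies. *)
have gap a b : X a -> Y b -> u1 xbar b <= u1 a ybar + eps.
  move=> Xa Yb.
  have h1 : u1 xbar b <= T%:R^-1 * \sum_(1 <= t < T.+1) u1 (x t) b.
    by rewrite /xbar Tn; apply: (convex_function_average vX (u1X Yb).1).
  have h2 : u2 a ybar <= T%:R^-1 * \sum_(1 <= t < T.+1) u2 a (y t).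
    by rewrite /ybar Tn; apply: (convex_function_average vY (u2Y Xa).1).
  rewrite zs// in h2.
  have E : \sum_(1 <= t < T.+1) u2 a (y t) = - \sum_(1 <= t < T.+1) u1 a (y t).
    by rewrite -sumrN; apply: eq_big_nat => t tT; rewrite zs//; exact: yY.
  rewrite E in h2.
  have h3 : T%:R^-1 * (\sum_(1 <= t < T.+1) u1 (x t) b -
      \sum_(1 <= t < T.+1) u1 a (y t)) <= eps.
    apply: le_trans eps_ge; rewrite [leRHS]mulrC ler_pM2l ?invr_gt0//.
    by apply: le_trans (duality_gap zs Xa Yb) _; rewrite lerD2l; lra.
  rewrite mulrBr in h3.
  move: (u1 xbar b) (u1 a ybar) (T%:R^-1 * \sum_(_ <= _ < _) u1 _ b) h1 h2 h3.
  by rewrite mulrN; move: (T%:R^-1 * _) => p c1 c2 q; lra.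
(* The two Nash conditions are [gap] at [b = ybar] and at [a = xbar]. *)
split=> // [a Xa|b Yb]; first exact: gap.
have := gap _ _ Xbar Yb; rewrite !zs//.
by move: (u1 xbar b) (u1 xbar ybar) => p q; lra.
Qed.

End alternating_hedge.

Theorem corollary5 (R : realType) :
  exists (C : R) (p : nat), 0 < C /\
  forall (d T : nat) (X Y : set 'rV[R]_d) (u1 u2 : 'rV[R]_d -> 'rV[R]_d -> R)
    (x y : nat -> 'rV[R]_d),
  (0 < d)%N -> (2 <= T)%N ->
  compact X -> compact Y ->
  convex_set (X : set (convex_lmodType 'rV[R]_d)) ->
  convex_set (Y : set (convex_lmodType 'rV[R]_d)) ->
  X° !=set0 -> Y° !=set0 ->
  (forall a b, X a -> Y b -> -1 <= u1 a b <= 1) ->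
  (forall a b, X a -> Y b -> -1 <= u2 a b <= 1) ->
  (forall b, Y b ->
     convex_function (X : set (convex_lmodType 'rV[R]_d)) (u1^~ b)) ->
  (forall a, X a ->
     convex_function (Y : set (convex_lmodType 'rV[R]_d)) (u2 a)) ->
  let eta := (d%:R * ln T%:R) `^ (1 / 3) * T%:R `^ (- (1 / 3)) in
  alternating_play (continuous_hedge eta X) (continuous_hedge eta Y)
    u1 u2 T x y ->
  let eps := C * ln T%:R ^+ p * (d%:R `^ (2 / 3) * T%:R `^ (- (2 / 3))) in
  ((forall a b, X a -> Y b -> u2 a b = - u1 a b) ->
     nash_equilibrium X Y u1 u2 eps
       (T%:R^-1 *: \sum_(1 <= t < T.+1) x t)
       (T%:R^-1 *: \sum_(1 <= t < T.+1) y t)) /\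
  coarse_correlated_equilibrium X Y u1 u2 eps
    (uniform_over ([seq (x t, y t) | t <- iota 1 T] ++
                   [seq (x t.+1, y t) | t <- iota 1 T])).
Proof.
(* The constant and the single logarithm are those of [hedge_rate]. *)
exists 148, 1%N; split=> // d T X Y u1 u2 x y d0 T2 cX cY vX vY iX iY b1 b2 c1 c2.
move=> eta play eps; have [eta0 epsP] := @hedge_rate R d T d0 T2.
have T0 : (0 < T)%N by exact: ltn_trans T2.
have bX : convex_body X by split.
have bY : convex_body Y by split.
have l1 b : Y b -> convex_loss X (u1^~ b).
  by move=> Yb; split=> [|a Xa]; [exact: c1|exact: b1].
have l2 a : X a -> convex_loss Y (u2 a).
  by move=> Xa; split=> [|b Yb]; [exact: c2|exact: b2].
split; first exact: (alternating_hedge_nash bX bY eta0 T0 l1 l2 play).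
exact: (alternating_hedge_cce bX bY eta0 T0 l1 l2 play).
Qed.
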